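(* Let $K$ be a number field, $p$ a prime number and $\zeta\in\mathbb{C}$ a primitive $p$-th root of unity, and assume $\zeta\notin K$ and that $p$ is unramified in $K$. Let $L=K(\alpha)$ be an extension of $K$ of degree $p$, where $\alpha\in\mathfrak{O}_L$ satisfies $a:=\alpha^p\in\mathfrak{O}_K$ and $a\equiv 1\pmod{p^2\mathfrak{O}_K}$, and assume $L/K$ is at most tamely ramified. With $E,G,N,H$ as in the context, let $\mathfrak{A}=\{h\in H: h\cdot\mathfrak{O}_L\subseteq\mathfrak{O}_L\}$. Then $\mathfrak{A}=\mathfrak{O}_E[N]^G$, and $\mathfrak{O}_L$ is a locally free $\mathfrak{A}$-module (of rank one). More precisely, for each prime ideal $\mathfrak{p}$ of $\mathfrak{O}_K$, a free generator of $\mathfrak{O}_{L,\mathfrak{p}}$ as an $\mathfrak{A}_{\mathfrak{p}}$-module is $$x_{\mathfrak{p}}=\begin{cases}\frac{1}{p}\sum_{j=0}^{p-1}\alpha^j & \text{if } \mathfrak{p}\mid p\mathfrak{O}_K,\\ \frac{1}{p}\sum_{j=0}^{p-1}\frac{\alpha^j}{\pi_{\mathfrak{p}}^{r_{\mathfrak{p}}(a^j)}} & \text{otherwise.}\end{cases}$$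
   Context: For a prime ideal $\mathfrak{p}$ of $\mathfrak{O}_K$: $K_{\mathfrak{p}}$ is the completion, $\mathfrak{O}_{K,\mathfrak{p}}$ its valuation ring, $\pi_{\mathfrak{p}}$ a uniformizer, $v_{\mathfrak{p}}$ the normalized valuation; for an $\mathfrak{O}_K$-module $Y$, $Y_{\mathfrak{p}}=\mathfrak{O}_{K,\mathfrak{p}}\otimes_{\mathfrak{O}_K}Y$; for $x\in K^\times$, $r_{\mathfrak{p}}(x)=\lfloor v_{\mathfrak{p}}(x)/p\rfloor$. Let $E=K(\alpha,\zeta)$, $G=\mathrm{Gal}(E/K)$ generated by $\sigma,\tau$ with $\sigma(\alpha)=\zeta\alpha$, $\sigma(\zeta)=\zeta$, $\tau(\alpha)=\alpha$, $\tau(\zeta)=\zeta^d$ ($d$ a fixed primitive root mod $p$). Let $G'=\langle\tau\rangle$, $X=G/G'$ (left cosets), $\bar\sigma^i=\sigma^iG'$, $\lambda:G\to\mathrm{Perm}(X)$ left translation, $\eta\in\mathrm{Perm}(X)$ given by $\eta(\bar\sigma^i)=\bar\sigma^{i-1}$, $N=\langle\eta\rangle$. $G$ acts on $E[N]$ by $g\cdot\sum_n c_nn=\sum_n g(c_n)\lambda(g)n\lambda(g)^{-1}$; $H=E[N]^G$, acting on $L$ by $\left(\sum_k c_k\eta^k\right)\cdot x=\sum_k c_k\sigma^k(x)$. $\mathfrak{O}_E[N]^G$ denotes the $G$-fixed elements of $E[N]$ all of whose coefficients lie in $\mathfrak{O}_E$. *)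

(* Defs.v *)
From HB Require Import structures.
From mathcomp Require Import all_boot all_order all_algebra all_fingroup.
From mathcomp Require Import all_solvable all_field.
From mathcomp Require Import generic_quotient ring_quotient.
From mathcomp Require Import boolp.
From mathcomp Require freeg.

Set Implicit Arguments.
Unset Strict Implicit.
Unset Printing Implicit Defensive.

Import Order.TTheory GRing.Theory Num.Theory.
Local Open Scope ring_scope.

Section Integers.
Variables (F0 : fieldType) (F : fieldExtType F0) (U : {subfield F}).

Definition algint : {pred F} :=
  fun x => (x \in U) && `[< integralOver (intr : int -> F) x >].

Lemma algintP x :
  reflect (x \in U /\ integralOver (intr : int -> F) x) (x \in algint).
Proof.
apply: (iffP andP) => -[xU /asboolP xi]; first by split.
by split.
Qed.

Lemma algint_subring : subring_closed algint.
Proof.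
split.
- by apply/algintP; split; [exact: mem1v | exact: integral1].
- move=> x y /algintP[xU xi] /algintP[yU yi]; apply/algintP.
  by split; [exact: rpredB | exact: integral_sub].
- move=> x y /algintP[xU xi] /algintP[yU yi]; apply/algintP.
  by split; [exact: rpredM | exact: integral_mul].
Qed.

HB.instance Definition _ := GRing.isSubringClosed.Build F algint algint_subring.

Definition intring := {x : F | x \in algint}.
HB.instance Definition _ := SubType.on intring.
HB.instance Definition _ := Choice.on intring.
HB.instance Definition _ := [SubChoice_isSubComNzRing of intring by <:].

End Integers.

Notation "''O' K" := (intring (aspacef K)) (at level 8, K at level 2) : type_scope.

Module IntringModule.
Section IntegersModule.
Variables (K : fieldExtType rat) (F : fieldExtType K) (U : {subfield F}).

Lemma algint_inA (r : 'O K) : (val r)%:A \in algint U.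
Proof.
case: r => r /= /algintP[_ ri]; apply/algintP; split; first exact: memvZ (mem1v _).
have -> : (intr : int -> F) = in_alg F \o intr.
  by apply: functional_extensionality_dep => n /=; rewrite -[RHS]/(in_alg F _) rmorph_int.
exact: (@integral_rmorph _ _ _ (intr : int -> K) (in_alg F)).
Qed.

Lemma algintZ (r : 'O K) (x : F) : x \in algint U -> val r *: x \in algint U.
Proof. by move=> xU; rewrite -mulr_algl rpredM ?algint_inA. Qed.

Definition intring_scale (r : 'O K) (x : intring U) : intring U :=
  Sub (val r *: val x) (algintZ r (valP x)).

Fact intring_scaleA a b x :
  intring_scale a (intring_scale b x) = intring_scale (a * b) x.
Proof. by apply: val_inj; rewrite /= scalerA. Qed.
Fact intring_scale1 : left_id 1 intring_scale.
Proof. by move=> x; apply: val_inj; rewrite /= scale1r. Qed.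
Fact intring_scaleDr : right_distributive intring_scale +%R.
Proof. by move=> r x y; apply: val_inj; rewrite /= scalerDr. Qed.
Fact intring_scaleDl x : {morph intring_scale^~ x : a b / a + b}.
Proof. by move=> a b; apply: val_inj; rewrite /= scalerDl. Qed.

HB.instance Definition _ := GRing.Zmodule_isLmodule.Build ('O K) (intring U)
  intring_scaleA intring_scale1 intring_scaleDr intring_scaleDl.

End IntegersModule.
End IntringModule.
Export IntringModule.

Fixpoint ideal_pow (R : comNzRingType) (P : {pred R}) (n : nat) : R -> Prop :=
  if n is n'.+1 then
    fun x => exists s : seq (R * R),
      (forall u, u \in s -> u.1 \in P /\ ideal_pow P n' u.2) /\
      x = \sum_(u <- s) u.1 * u.2
  else fun=> True.

Definition nonzero_ideal (R : comNzRingType) (P : {pred R}) :=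
  exists2 x : R, x \in P & x != 0.

(* e(P/p) = 1 for every prime P of O_K above p; the residue fields are finite,
   hence residual extensions are separable. *)
Definition unramified_in (p : nat) (K : fieldExtType rat) :=
  forall P : prime_idealr ('O K), p%:R \in P -> ~ ideal_pow P 2 p%:R.

Section Tame.
Variables (K : fieldExtType rat) (F : fieldExtType K) (U : {subfield F}).

(* e is the ramification index of Q over P := Q \cap O_K, i.e. P O_U is
   contained in Q^e but not in Q^(e+1). *)
Definition ram_index (Q : {pred intring U}) (e : nat) :=
  let extends_in n := forall x : 'O K,
    x *: (1 : intring U) \in Q -> ideal_pow Q n (x *: (1 : intring U)) in
  extends_in e /\ ~ extends_in e.+1.

(* Residue fields are finite, so only the ramification index matters; the
   residue characteristic of Q is the prime number q lying in Q. *)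
Definition at_most_tame :=
  forall Q : prime_idealr (intring U), nonzero_ideal Q ->
  forall e q : nat, ram_index Q e -> prime q -> q%:R \in Q -> ~~ (q %| e)%N.

End Tame.

Module TensorProduct.
(* S \otimes_R M, with S an R-module through f. *)
Section Tensor.
Import freeg.
Variables (R S : comNzRingType) (f : R -> S) (M : lmodType R).

Local Notation free := {freeg M / S}.
Local Notation gen s m := (<< s *g m >> : free).

(* The submodule generated by the defining relations; the remaining relation
   (s + s') \otimes m = s \otimes m + s' \otimes m already holds in the free
   S-module on M. *)
Definition tensor_rel : {pred free} := fun D =>
  `[< forall Q : {pred free}, submod_closed Q ->
      (forall m m', gen 1 (m + m') - gen 1 m - gen 1 m' \in Q) ->
      (forall r m, gen 1 (r *: m) - gen (f r) m \in Q) -> D \in Q >].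

Fact tensor_rel_submod : submod_closed tensor_rel.
Proof.
split; first by apply/asboolP => Q [].
move=> c x y /asboolP xQ /asboolP yQ; apply/asboolP => Q clQ QD QZ.
by apply: clQ.2; [exact: xQ | exact: yQ].
Qed.

HB.instance Definition _ :=
  GRing.isZmodClosed.Build free tensor_rel (GRing.submod_closedB tensor_rel_submod).

Definition tensor := Quotient.quot tensor_rel.
HB.instance Definition _ := GRing.Zmodule.on tensor.

Local Notation "\pi D" := (\pi_(Quotient.quot tensor_rel)%qT D : tensor)
  (at level 10, D at level 8).

Definition tensor_scale (s : S) (x : tensor) : tensor := \pi (s *: repr x).

Fact tensor_eqP D D' : reflect (\pi D = \pi D') (D - D' \in tensor_rel).
Proof. by rewrite Quotient.idealrBE; apply: eqP. Qed.

Fact tensor_piD D D' : \pi (D + D') = \pi D + \pi D'.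
Proof. exact: (raddfD (\pi_(Quotient.quot tensor_rel)%qT)). Qed.

Fact tensor_rep (x : tensor) : \pi (repr x) = x.
Proof. exact: reprK. Qed.

Fact tensor_piZ s D : tensor_scale s (\pi D) = \pi (s *: D).
Proof.
apply/tensor_eqP; rewrite -scalerBr -[s *: _]addr0.
apply: tensor_rel_submod.2; last exact: tensor_rel_submod.1.
by apply/tensor_eqP; rewrite tensor_rep.
Qed.

Fact tensor_scaleA a b x :
  tensor_scale a (tensor_scale b x) = tensor_scale (a * b) x.
Proof. by rewrite -[x]tensor_rep !tensor_piZ scalerA. Qed.
Fact tensor_scale1 : left_id 1 tensor_scale.
Proof. by move=> x; rewrite -[x]tensor_rep !tensor_piZ scale1r. Qed.
Fact tensor_scaleDr : right_distributive tensor_scale +%R.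
Proof.
move=> s x y; rewrite -[x]tensor_rep -[y]tensor_rep -tensor_piD !tensor_piZ.
by rewrite -tensor_piD scalerDr.
Qed.
Fact tensor_scaleDl x : {morph tensor_scale^~ x : a b / a + b}.
Proof.
by move=> a b; rewrite -[x]tensor_rep !tensor_piZ -tensor_piD scalerDl.
Qed.

HB.instance Definition _ := GRing.Zmodule_isLmodule.Build S tensor
  tensor_scaleA tensor_scale1 tensor_scaleDr tensor_scaleDl.

Definition tens (s : S) (m : M) : tensor := \pi (gen s m).

(* The additive map induced by an R-balanced biadditive map phi, meaningful
   only for such phi: see tensor_liftE and tensor_liftD. *)
Definition tensor_lift (W : zmodType) (phi : S -> M -> W) (x : tensor) : W :=
  \sum_(m <- dom (repr x)) phi (coeff m (repr x)) m.

Lemma tensZ c s m : c *: tens s m = tens (c * s) m.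
Proof.
rewrite [LHS]tensor_piZ; congr (\pi _); apply/eqP/freeg_eqP => k.
by rewrite coeffZ !coeffU mulrA.
Qed.

Lemma tensDl s s' m : tens (s + s') m = tens s m + tens s' m.
Proof. by rewrite /tens -tensor_piD freegUD. Qed.

Lemma tensDr s m m' : tens s (m + m') = tens s m + tens s m'.
Proof.
rewrite -[s]mulr1 -!tensZ -scalerDr; congr (_ *: _).
rewrite /tens -tensor_piD; apply/tensor_eqP; rewrite opprD addrA.
by apply/asboolP => Q _ QD _.
Qed.

Lemma tens_balanced s r m : tens (s * f r) m = tens s (r *: m).
Proof.
rewrite -[in RHS](mulr1 s) -!tensZ; congr (_ *: _).
by apply/esym/tensor_eqP; apply/asboolP => Q _ _.
Qed.

Lemma tensor_ind (P : tensor -> Prop) :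
  P 0 -> (forall x y, P x -> P y -> P (x + y)) -> (forall s m, P (tens s m)) ->
  forall x, P x.
Proof.
move=> P0 PD Pt x; rewrite -[x]tensor_rep -[repr x]freeg_sumE.
rewrite (@raddf_sum _ _ (\pi_(Quotient.quot tensor_rel)%qT)).
by apply: big_ind => // m _; apply: Pt.
Qed.

Section Lift.
Variables (W : zmodType) (phi : S -> M -> W).
Hypothesis phiDl : forall s s' m, phi (s + s') m = phi s m + phi s' m.
Hypothesis phiDr : forall s m m', phi s (m + m') = phi s m + phi s m'.
Hypothesis phiB : forall s r m, phi (s * f r) m = phi s (r *: m).

Let phi0 m : phi 0 m = 0.
Proof. by apply: (addrI (phi 0 m)); rewrite -phiDl !addr0. Qed.

Let pre (D : free) := \sum_(m <- dom D) phi (coeff m D) m.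

Let pre_sub s D : uniq s -> {subset dom D <= s} ->
  pre D = \sum_(m <- s) phi (coeff m D) m.
Proof.
move=> us sD; rewrite (bigID (mem (dom D))) /= [X in _ + X]big1 ?addr0; last first.
  by move=> m mD; rewrite coeff_outdom.
rewrite -big_filter; apply: perm_big; apply: uniq_perm; rewrite ?uniq_dom //.
  exact: filter_uniq.
by move=> m; rewrite mem_filter; case: (boolP (m \in dom D)) => //= /sD ->.
Qed.

Let preD D D' : pre (D + D') = pre D + pre D'.
Proof.
pose s := undup (dom D ++ dom D'); have us : uniq s by exact: undup_uniq.
rewrite !(pre_sub us) -?big_split /=.
- by apply: eq_bigr => m _; rewrite coeffD phiDl.
- by move=> m mD; rewrite mem_undup mem_cat mD orbT.
- by move=> m mD; rewrite mem_undup mem_cat mD.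
- by move=> m /domD_subset; rewrite mem_undup.
Qed.

Let preU s m : pre (gen s m) = phi s m.
Proof.
rewrite (@pre_sub [:: m]) //; first by rewrite big_seq1 coeffU eqxx mulr1.
move=> k; rewrite mem_dom coeffU inE.
by case: (m =P k) => [-> | _]; rewrite ?eqxx // mulr0 eqxx.
Qed.

Let preB D D' : pre (D - D') = pre D - pre D'.
Proof. by apply/eqP; rewrite eq_sym subr_eq -preD subrK. Qed.

Let scaleU c s m : c *: gen s m = gen (c * s) m.
Proof. by apply/eqP/freeg_eqP => k; rewrite coeffZ !coeffU mulrA. Qed.

Let pre_rel D : D \in tensor_rel -> pre D = 0.
Proof.
move/asboolP => /(_ (fun D => `[< forall c, pre (c *: D) = 0 >])) H.
have /asboolP/(_ 1) : `[< forall c, pre (c *: D) = 0 >].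
  apply: H; last 2 first.
  - move=> m m'; apply/asboolP => c.
    by rewrite !scalerBr !preB !scaleU !preU !mulr1 phiDr addrAC addrK subrr.
  - move=> r m; apply/asboolP => c.
    by rewrite scalerBr preB !scaleU !preU mulr1 phiB subrr.
  split.
    by apply/asboolP => c; rewrite scaler0 /pre dom0 big_nil.
  move=> a x y /asboolP xQ /asboolP yQ; apply/asboolP => c.
  by rewrite scalerDr scalerA preD xQ yQ addr0.
by rewrite scale1r.
Qed.

Let pre_pi D : tensor_lift phi (\pi D) = pre D.
Proof.
apply/eqP; rewrite -subr_eq0 -preB; apply/eqP/pre_rel.
by apply/tensor_eqP; rewrite tensor_rep.
Qed.

Lemma tensor_liftE s m : tensor_lift phi (tens s m) = phi s m.
Proof. by rewrite pre_pi preU. Qed.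

Lemma tensor_liftD x y :
  tensor_lift phi (x + y) = tensor_lift phi x + tensor_lift phi y.
Proof. by rewrite -[x]tensor_rep -[y]tensor_rep -tensor_piD !pre_pi preD. Qed.

End Lift.
End Tensor.
End TensorProduct.
Export TensorProduct.

(* v x >= n, with the convention v 0 = +oo (the value of v at 0 is junk). *)
Definition vge (F : fieldType) (v : F -> int) (n : int) (x : F) : bool :=
  (x == 0) || (n <= v x).

(* A completion is a complete field for a discrete valuation in which K is
   dense and whose valuation restricts on K to the normalized P-adic one, i.e.
   v x >= n iff x \in P^n, for x \in O_K. It is unique up to isomorphism. *)
Record completion (K : fieldExtType rat) (P : {pred 'O K}) := Completion {
  cfield :> fieldType;
  cemb : {rmorphism K -> cfield};
  cval : cfield -> int;
  cvalM : forall x y, x != 0 -> y != 0 -> cval (x * y) = cval x + cval y;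
  cvalD : forall n x y, vge cval n x -> vge cval n y -> vge cval n (x + y);
  cval_adic : forall (x : 'O K) (n : nat),
    vge cval n%:Z (cemb (val x)) <-> ideal_pow P n x;
  cdense : forall (y : cfield) (n : int), exists x : K,
    vge cval n (y - cemb x);
  ccomplete : forall u : nat -> cfield,
    (forall n : int, exists N : nat, forall i j : nat,
      (N <= i)%N -> (N <= j)%N -> vge cval n (u i - u j)) ->
    exists l : cfield, forall n : int, exists N : nat, forall i : nat,
      (N <= i)%N -> vge cval n (u i - l)
}.

Section ValuationRing.
Variables (K : fieldExtType rat) (P : {pred 'O K}) (C : completion P).

Definition valint : {pred C} := vge (@cval _ _ C) 0.

Fact valint_subring : subring_closed valint.
Proof.
have vE x : (x \in valint) = (x == 0) || (0 <= cval x) by [].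
have v1 : cval (1 : C) = 0.
  have := @cvalM _ _ C 1 1 (oner_neq0 _) (oner_neq0 _).
  by rewrite mulr1 => /eqP; rewrite -subr_eq subrr eq_sym => /eqP.
have vN1 : cval (-1 : C) = 0.
  have N1 : (-1 : C) != 0 by rewrite oppr_eq0 oner_eq0.
  have := @cvalM _ _ C (-1) (-1) N1 N1; rewrite mulrNN mulr1 v1 => /esym/eqP.
  by rewrite -mulr2n mulrn_eq0 => /eqP.
have vM (x y : C) : x \in valint -> y \in valint -> x * y \in valint.
  rewrite !vE; case: eqP => [-> | /eqP x0] /=; first by rewrite mul0r eqxx.
  case: eqP => [-> | /eqP y0] /=; first by rewrite mulr0 eqxx.
  by move=> vx vy; rewrite cvalM // addr_ge0 ?orbT.
split=> //; first by rewrite vE v1 lexx orbT.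
move=> x y xv yv; rewrite -mulN1r; apply: cvalD => //.
by apply: vM => //; rewrite vE vN1 lexx orbT.
Qed.

HB.instance Definition _ := GRing.isSubringClosed.Build C valint valint_subring.

Definition valring := {x : C | x \in valint}.
HB.instance Definition _ := SubType.on valring.
HB.instance Definition _ := Choice.on valring.
HB.instance Definition _ := [SubChoice_isSubComNzRing of valring by <:].

Fact cemb_valint (x : 'O K) : cemb C (val x) \in valint.
Proof. exact/(@cval_adic _ _ C x 0). Qed.

Definition cemb_int (x : 'O K) : valring := Sub (cemb C (val x)) (cemb_valint x).

Fact cemb_int_zmod : zmod_morphism cemb_int.
Proof. by move=> x y; apply: val_inj; rewrite /= !rmorphB. Qed.
Fact cemb_int_monoid : monoid_morphism cemb_int.
Proof.
split; first by apply: val_inj; rewrite /= !rmorph1.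
by move=> x y; apply: val_inj; rewrite /= !rmorphM.
Qed.
HB.instance Definition _ := GRing.isZmodMorphism.Build _ _ cemb_int cemb_int_zmod.
HB.instance Definition _ :=
  GRing.isMonoidMorphism.Build _ _ cemb_int cemb_int_monoid.

(* For an O_K-module Y, the module Y_P := O_{K,P} \otimes_{O_K} Y. *)
Definition at_prime (Y : lmodType ('O K)) := tensor cemb_int Y.
HB.instance Definition _ Y := GRing.Lmodule.on (at_prime Y).

End ValuationRing.

(* In MathComp, (g * h)%g is the composite h \o g, for permutations as for
   elements of gal_of. With respect to composition of functions, the left coset
   of g modulo H is therefore H :* g, and left translation by g maps H :* h to
   H :* (h * g). *)
Section Cosets.
Variables (gT : finGroupType) (H : {group gT}).

Definition cosets := {C : {set gT} | C \in rcosets H [set: gT]}.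
HB.instance Definition _ := SubType.on cosets.
HB.instance Definition _ := Finite.on cosets.

Fact mkcoset_subproof g : (H :* g)%g \in rcosets H [set: gT].
Proof. by apply/rcosetsP; exists g; rewrite ?inE. Qed.
Definition mkcoset g : cosets := Sub ((H :* g)%g) (mkcoset_subproof g).

Fact ltrans_subproof g (C : cosets) : (val C :* g)%g \in rcosets H [set: gT].
Proof.
case: C => C /= /rcosetsP[h _ ->]; apply/rcosetsP; exists (h * g)%g.
  by rewrite inE.
by rewrite rcosetM.
Qed.
Definition ltrans_fun g (C : cosets) : cosets := Sub ((val C :* g)%g) (ltrans_subproof g C).

Fact ltrans_inj g : injective (ltrans_fun g).
Proof. by move=> C D [/rcoset_inj CD]; apply: val_inj. Qed.
Definition ltrans g : {perm cosets} := perm (@ltrans_inj g).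

Lemma ltransE g h : ltrans g (mkcoset h) = mkcoset (h * g)%g.
Proof. by apply: val_inj; rewrite permE /= rcosetM. Qed.

End Cosets.

Section HopfAlgebra.
Variables (K : fieldExtType rat) (E : splittingFieldType K).
Variables (alpha : E) (sigma tau : gal_of {:E}).

(* X = G / <tau>: the type gal_of {:E} is all of G = Gal(E / K). *)
Definition galX := cosets <[tau]>.
HB.instance Definition _ := Finite.on galX.

Variable eta : {perm galX}.

Local Notation L := <<1; alpha>>%AS.

(* The element \sum_n c_n n of E[Perm(X)] is represented by the function c. *)
Local Notation EPerm := {ffun {perm galX} -> E}.

(* g . \sum_n c_n n = \sum_n g(c_n) (lambda(g) n lambda(g)^-1); in MathComp
   lambda(g) \o n \o lambda(g)^-1 is n ^ lambda(g). *)
Definition gal_act (g : gal_of {:E}) (c : EPerm) : EPerm :=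
  [ffun m => \sum_(n | (n ^ ltrans <[tau]> g)%g == m) g (c n)].

Definition hopf_alg (h : EPerm) :=
  (forall n, n \notin <[eta]>%g -> h n = 0) /\
  (forall g, g \in 'Gal({:E} / 1)%g -> gal_act g h = h).

(* (\sum_k c_k eta^k) . x = \sum_k c_k sigma^k(x); eta has order p, and the
   formula depicts the action of H only for x in L. *)
Definition hopf_act (h : EPerm) (x : E) : E :=
  \sum_(k < #[eta]%g) h (eta ^+ k)%g * (sigma ^+ k)%g x.

(* The set A of all h in H such that h . O_L is contained in O_L *)
Definition assoc_order : {pred EPerm} := fun h =>
  `[< hopf_alg h /\ {in algint L, forall x, hopf_act h x \in algint L} >].

(* O_E[N]^G *)
Definition int_hopf_order : {pred EPerm} := fun h =>
  `[< hopf_alg h /\ forall n, h n \in algint {:E}%AS >].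

Lemma gal_actE g c n : gal_act g c (n ^ ltrans <[tau]> g)%g = g (c n).
Proof.
rewrite ffunE (big_pred1 n) // => m; apply/eqP/eqP => [|-> //].
exact: conjg_inj.
Qed.

Fact gal_act_linear g (r : K) c c' :
  gal_act g (r *: c + c') = r *: gal_act g c + gal_act g c'.
Proof.
apply/ffunP => m; rewrite -[m](conjgKV (ltrans <[tau]> g)) gal_actE !ffunE.
rewrite linearP /=; congr (r *: _ + _).
  by rewrite -gal_actE ffunE.
by rewrite -gal_actE ffunE.
Qed.

Fact hopf_act_linear (r : K) h h' x :
  hopf_act (r *: h + h') x = r *: hopf_act h x + hopf_act h' x.
Proof.
rewrite /hopf_act scaler_sumr -big_split; apply: eq_bigr => k _ /=.
by rewrite !ffunE mulrDl scalerAl.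
Qed.

Fact hopf_act_add h x y : hopf_act h (x + y) = hopf_act h x + hopf_act h y.
Proof.
by rewrite /hopf_act -big_split; apply: eq_bigr => k _; rewrite raddfD mulrDr.
Qed.

Fact hopf_act_scale h (r : K) x : hopf_act h (r *: x) = r *: hopf_act h x.
Proof.
by rewrite /hopf_act scaler_sumr; apply: eq_bigr => k _; rewrite linearZ /= scalerAr.
Qed.

Fact assoc_order0 : 0 \in assoc_order.
Proof.
apply/asboolP; split.
  split=> [n _ | g _]; first by rewrite ffunE.
  apply/ffunP => m; rewrite -[m](conjgKV (ltrans <[tau]> g)) gal_actE !ffunE.
  exact: raddf0.
move=> x _; rewrite (_ : hopf_act 0 x = 0) ?rpred0 //.
by rewrite /hopf_act big1 // => k _; rewrite ffunE mul0r.
Qed.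

Fact assoc_order_linear (r : 'O K) h h' :
  h \in assoc_order -> h' \in assoc_order -> val r *: h + h' \in assoc_order.
Proof.
move=> /asboolP[[hN hG] hO] /asboolP[[hN' hG'] hO']; apply/asboolP.
split; first split=> [n nN | g gG].
- by rewrite !ffunE hN // hN' // scaler0 addr0.
- by rewrite gal_act_linear hG // hG'.
by move=> x xL; rewrite hopf_act_linear rpredD ?algintZ ?hO ?hO'.
Qed.

Fact assoc_order_zmod : zmod_closed assoc_order.
Proof.
split=> [|h h' hA hA']; first exact: assoc_order0.
rewrite -[h]scale1r addrC -scaleN1r -[1 in X in _ + X]/(val (1 : 'O K)) scale1r.
by rewrite -[-1]/(val (-1 : 'O K)); apply: assoc_order_linear.
Qed.

HB.instance Definition _ :=
  GRing.isZmodClosed.Build EPerm assoc_order assoc_order_zmod.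

Definition assocO := {h : EPerm | h \in assoc_order}.
HB.instance Definition _ := SubType.on assocO.
HB.instance Definition _ := Choice.on assocO.
HB.instance Definition _ := [SubChoice_isSubZmodule of assocO by <:].

Fact assoc_scale_subproof (r : 'O K) (h : assocO) : val r *: val h \in assoc_order.
Proof.
by rewrite -[_ *: _]addr0 assoc_order_linear ?assoc_order0 //; case: h.
Qed.
Definition assoc_scale r h : assocO := Sub (val r *: val h) (assoc_scale_subproof r h).

Fact assoc_scaleA a b x : assoc_scale a (assoc_scale b x) = assoc_scale (a * b) x.
Proof. by apply: val_inj; rewrite /= scalerA. Qed.
Fact assoc_scale1 : left_id 1 assoc_scale.
Proof. by move=> x; apply: val_inj; rewrite /= scale1r. Qed.
Fact assoc_scaleDr : right_distributive assoc_scale +%R.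
Proof. by move=> r x y; apply: val_inj; rewrite /= scalerDr. Qed.
Fact assoc_scaleDl x : {morph assoc_scale^~ x : a b / a + b}.
Proof. by move=> a b; apply: val_inj; rewrite /= scalerDl. Qed.

HB.instance Definition _ := GRing.Zmodule_isLmodule.Build ('O K) assocO
  assoc_scaleA assoc_scale1 assoc_scaleDr assoc_scaleDl.

Fact assoc_act_subproof (h : assocO) (x : intring L) :
  hopf_act (val h) (val x) \in algint L.
Proof. by case: h x => h /= /asboolP[_ hO] [x xO] /=; apply: hO. Qed.
Definition assoc_act (h : assocO) (x : intring L) : intring L :=
  Sub (hopf_act (val h) (val x)) (assoc_act_subproof h x).

Section Local.
Variables (P : {pred 'O K}) (C : completion P).

(* The action of A_P on O_{L,P}: (s \otimes h) (t \otimes y) = s t \otimes h y *)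
Definition local_act (h : at_prime C assocO) (x : at_prime C (intring L)) :
    at_prime C (intring L) :=
  tensor_lift (fun (s : valring C) (b : assocO) =>
    s *: tensor_lift (fun (t : valring C) (y : intring L) =>
           tens (cemb_int C) t (assoc_act b y)) x) h.

(* Every element of O_{L,P} is h . x for a unique h in A_P. *)
Definition free_generator (x : at_prime C (intring L)) :=
  bijective (fun h : at_prime C assocO => local_act h x).

(* The canonical map O_{L,P} -> L_P = K_P \otimes_K L *)
Definition to_local_field (x : at_prime C (intring L)) :
    tensor (cemb C) (subvs_of L) :=
  tensor_lift (fun (s : valring C) (y : intring L) =>
    tens (cemb C) (val s) (vsproj L (val y))) x.

Let lact_add b (x y : intring L) :
  assoc_act b (x + y) = assoc_act b x + assoc_act b y.
Proof. by apply: val_inj; rewrite /= hopf_act_add. Qed.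
Let lact_scale b (r : 'O K) (x : intring L) :
  assoc_act b (r *: x) = r *: assoc_act b x.
Proof. by apply: val_inj; rewrite /= hopf_act_scale. Qed.
Let lact_addl b b' (x : intring L) :
  assoc_act (b + b') x = assoc_act b x + assoc_act b' x.
Proof.
apply: val_inj; rewrite -[b]scale1r /=.
by rewrite hopf_act_linear scale1r scale1r.
Qed.
Let lact_scalel (r : 'O K) b (x : intring L) :
  assoc_act (r *: b) x = r *: assoc_act b x.
Proof.
apply: val_inj; rewrite /=.
rewrite -[X in hopf_act X]addr0 hopf_act_linear [X in _ + X](_ : _ = 0) ?addr0 //.
by rewrite /hopf_act big1 // => k _; rewrite ffunE mul0r.
Qed.

Let inner b := tensor_lift (f := cemb_int C)
  (fun (t : valring C) (y : intring L) => tens (cemb_int C) t (assoc_act b y)).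

Let innerE b t y :
  inner b (tens (cemb_int C) t y) = tens (cemb_int C) t (assoc_act b y).
Proof.
apply: tensor_liftE => [t1 t2 m|t1 m m'|t1 r m]; first exact: tensDl.
- by rewrite lact_add tensDr.
- by rewrite lact_scale tens_balanced.
Qed.

Let innerD b x y : inner b (x + y) = inner b x + inner b y.
Proof.
apply: tensor_liftD => [t1 t2 m|t1 m m'|t1 r m]; first exact: tensDl.
- by rewrite lact_add tensDr.
- by rewrite lact_scale tens_balanced.
Qed.

Let inner0 b : inner b 0 = 0.
Proof. by apply: (addrI (inner b 0)); rewrite -innerD !addr0. Qed.

Let inner_addl b b' x : inner (b + b') x = inner b x + inner b' x.
Proof.
elim/tensor_ind: x => [|x y IHx IHy|t y]; first by rewrite !inner0 addr0.
  by rewrite !innerD IHx IHy addrACA.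
by rewrite !innerE lact_addl tensDr.
Qed.

Let inner_scalel r b x : inner (r *: b) x = cemb_int C r *: inner b x.
Proof.
elim/tensor_ind: x => [|x y IHx IHy|t y]; first by rewrite !inner0 scaler0.
  by rewrite !innerD IHx IHy scalerDr.
by rewrite !innerE lact_scalel tensZ mulrC tens_balanced.
Qed.

Lemma local_actE s t (h : assocO) (y : intring L) :
  local_act (tens (cemb_int C) s h) (tens (cemb_int C) t y) =
  tens (cemb_int C) (s * t) (assoc_act h y).
Proof.
rewrite /local_act -/inner tensor_liftE => [|s1 s2 b|s1 b b'|s1 r b].
- by rewrite -/(inner h _) innerE tensZ.
- by rewrite scalerDl.
- by rewrite -scalerDr; congr (_ *: _); apply: inner_addl.
- by rewrite -scalerA; congr (_ *: _); apply/esym/inner_scalel.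
Qed.

Lemma local_actDl h h' x : local_act (h + h') x = local_act h x + local_act h' x.
Proof.
apply: tensor_liftD => [s1 s2 b|s1 b b'|s1 r b].
- by rewrite scalerDl.
- by rewrite -scalerDr; congr (_ *: _); apply: inner_addl.
- by rewrite -scalerA; congr (_ *: _); apply/esym/inner_scalel.
Qed.

Lemma to_local_fieldE s (y : intring L) :
  to_local_field (tens (cemb_int C) s y) =
  tens (cemb C) (val s) (vsproj L (val y)).
Proof.
apply: tensor_liftE => [s1 s2 m|s1 m m'|s1 r m]; first exact: tensDl.
- by rewrite /= linearD tensDr.
- by rewrite /= linearZ tens_balanced.
Qed.

End Local.

Definition locally_free_rank1 :=
  forall (P : prime_idealr ('O K)) (C : completion P), nonzero_ideal P ->
  exists x : at_prime C (intring L), free_generator x.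

(* r_P(x), where %/ is Euclidean division, that is floor as p > 0 *)
Definition rfloor (p : nat) (P : {pred 'O K}) (C : completion P) (x : K) : int :=
  (cval (cemb C x) %/ p%:Z)%Z.

(* x_P as an element of L_P = K_P \otimes_K L *)
Definition xgen (p : nat) (a : K) (P : {pred 'O K}) (C : completion P) (pi : C) :
    tensor (cemb C) (subvs_of L) :=
  if p%:R \in P then
    tens (cemb C) 1 (vsproj L ((p%:R)^-1 * \sum_(j < p) alpha ^+ j))
  else
    (p%:R)^-1 *: \sum_(j < p)
      tens (cemb C) (pi ^ rfloor p C (a ^+ j))^-1 (vsproj L (alpha ^+ j)).

End HopfAlgebra.

(* Main.v *)
Require Import Defs.
From HB Require Import structures.
From mathcomp Require Import all_boot all_order all_algebra all_fingroup.
From mathcomp Require Import all_solvable all_field.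
From mathcomp Require Import ring_quotient boolp ring zify.

Set Implicit Arguments.
Unset Strict Implicit.
Unset Printing Implicit Defensive.

Import Order.TTheory GRing.Theory Num.Theory.
Local Open Scope ring_scope.

(** The powers of alpha diagonalize the problem. If h = sum_k c_k eta^k is fixed by G, then h acts
    on alpha^j through lam_j = sum_k c_k zeta^(jk), and lam_j lies in K; Fourier inversion recovers
    the c_k. So H becomes K^p acting coordinatewise on the sum of the lines K alpha^j. Both orders
    are shown to consist of the sequences in O_K with lam_j = lam_0 modulo p ([hopf_coef_int],
    [hopf_eigenvalue_int], [assoc_order_eq]).

    That O_E[N]^G preserves O_L is clear, since automorphisms preserve integers. Conversely, let h
    preserve O_L. Iterating h on alpha^j shows that lam_j is almost integral. The element x = (1/p)
    sum_j alpha^j is integral because a = 1 modulo p^2 ([geometric_int]), and h x has coordinates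
    lam_j / p. The congruence then follows from [coef_congr]: if y = sum_j m_j alpha^j is integral,
    so is a m_j - m_0. Indeed the trace of y (alpha^(p-j) - 1) is p (a m_j - m_0); by Frobenius
    alpha^(p-j) - 1 is nilpotent modulo p, hence so is the trace, and p O_K is radical because p is
    unramified ([unramified_radical]).

    For P above p, a is a unit at P, and the same congruence says that lam_j = p a m_j is an
    admissible sequence, whose operator sends x to a y: so x generates freely ([free_at_p]). For P
    away from p, p is a unit, the projections onto the alpha^j exist in A_P, and it remains to see
    that the alpha^j / pi^(r_j) form a basis of O_{L,P} ([rcoord_int], [tens_rbasis],
    [free_away_from_p]). This comes again from pairing with alpha^(p-j) under the trace, nilpotence
    modulo P supplying the factor lost in rounding.

    The arithmetic of O_K rests on the finiteness of O_K / N ([finite_mod]), from which the local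
    invertibility of primes is deduced ([prime_invertible]). *)

Lemma fieldExt_natr_eq0 (F0 : fieldType) (F : fieldExtType F0) n :
  (n%:R == 0 :> F) = (n%:R == 0 :> F0).
Proof. by rewrite -(rmorph_nat (in_alg F)) fmorph_eq0. Qed.

Lemma rat_fieldExt_natr_eq0 (K : fieldExtType rat) n : (n%:R == 0 :> K) = (n == 0)%N.
Proof. by rewrite fieldExt_natr_eq0 pnatr_eq0. Qed.

(** * Algebraic integers, finiteness of O_K / N *)

Section Integral.
Variables (F0 : fieldType) (F : fieldExtType F0).

Lemma algintfP (x : F) : reflect (integralOver (intr : int -> F) x) (x \in algint {:F}%AS).
Proof. by apply: (iffP (algintP _ _)) => [[] | ]; rewrite ?memvf. Qed.

Lemma monic_root_algint (q : {poly F}) y :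
  q \is monic -> root q y -> (forall i, q`_i \in algint {:F}%AS) -> y \in algint {:F}%AS.
Proof.
move=> mq qy qO; apply/algintfP; apply: (@integral_root_monic _ _ (intr : int -> F)) mq qy _.
by apply/(integral_poly (intr : int -> F)) => i; apply/algintfP.
Qed.

End Integral.

Section NumberField.
Variable K : fieldExtType rat.
Local Notation OK := (algint (aspacef K)).

(** If D clears the coefficients of the minimal polynomial m of y, of degree n, then D y is a root
    of D^n m(X / D), which is monic with integral coefficients. *)
Lemma clear_denominator y : exists2 N : nat, (0 < N)%N & N%:R * y \in OK.
Proof.
set m := minPoly 1 y.
have [D D0 HD] : exists2 D : nat, (0 < D)%N & forall i, D%:R * m`_i \in OK.
  have coefm i : exists2 D : nat, (0 < D)%N & D%:R * m`_i \in OK.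
    have /vlineP[r ->] := polyOverP (minPolyOver 1 y) i.
    exists `|denq r|%N; first by rewrite absz_gt0 denq_neq0.
    rewrite -[X in _ * X]/(in_alg K r) -(rmorph_nat (in_alg K)) -rmorphM /=.
    have -> : (`|denq r|%N)%:R * r = (numq r)%:~R.
      by rewrite mulrC -[X in X * _]divq_num_den pmulrn absz_denq divfK // intr_eq0 denq_neq0.
    by rewrite -[X in X \in _]/(in_alg K _) rmorph_int rpred_int.
  have [f f0 fO] : exists2 f : nat -> nat, (forall i, 0 < f i)%N & forall i, (f i)%:R * m`_i \in OK.
    have /choice[f Hf] : forall i, exists D : nat, (0 < D)%N /\ D%:R * m`_i \in OK.
      by move=> i; have [D] := coefm i; exists D.
    by exists f => i; have [] := Hf i.
  exists (\prod_(i < size m) f i)%N; first by rewrite prodn_gt0.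
  move=> i; have [im | /leq_sizeP -> //] := ltnP i (size m); last by rewrite mulr0 rpred0.
  by rewrite (bigD1 (Ordinal im)) //= mulnC natrM -mulrA rpredM ?rpred_nat.
exists D => //.
have mm : m \is monic := monic_minPoly 1 y.
have sm : (0 < size m)%N by rewrite size_poly_gt0 monic_neq0.
pose q := \poly_(i < size m) (m`_i * D%:R ^+ (size m).-1.-1.+1 / D%:R ^+ i).
have Dn0 : D%:R != 0 :> K by rewrite rat_fieldExt_natr_eq0 -lt0n.
have sm1 : (1 < size m)%N.
  by rewrite size_minPoly ltnS adjoin_degreeE divn_gt0 ?adim_gt0 // dimvS // subv_adjoin.
have E1 : (size m).-1.-1.+1 = (size m).-1 by rewrite prednK // -ltnS prednK.
have q_lead : q`_(size m).-1 = 1.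
  by rewrite coef_poly prednK // leqnn E1 -mulrA divff ?expf_neq0 // mulr1; apply/monicP.
have sq : size q = size m.
  apply/eqP; rewrite eqn_leq size_poly /= -(prednK sm) ltnNge.
  by apply/negP => /leq_sizeP/(_ _ (leqnn _))/eqP; rewrite q_lead oner_eq0.
apply: (@monic_root_algint _ _ q).
- by rewrite monicE lead_coefE sq q_lead.
- rewrite /root horner_coef sq; apply/eqP.
  rewrite [LHS](_ : _ = D%:R ^+ (size m).-1 * m.[y]); last first.
    rewrite horner_coef mulr_sumr; apply: eq_bigr => i _.
    rewrite coef_poly ltn_ord E1 exprMn [LHS]mulrA divfK ?expf_neq0 //.
    by rewrite [m`_i * _]mulrC mulrA.
  by rewrite minPolyxx mulr0.
move=> i; rewrite coef_poly; case: ltnP => [im|]; last by rewrite rpred0.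
have [-> | ni] := eqVneq i (size m).-1.
  rewrite E1 -mulrA divff ?expf_neq0 // mulr1 -lead_coefE (monicP mm).
  exact: rpred1.
have {ni}im : (i < (size m).-1)%N by rewrite ltn_neqAle ni -ltnS prednK.
rewrite -mulrA E1 -(subnK (ltnW im)) exprD mulfK ?expf_neq0 //.
rewrite -(subnSK im) exprS mulrA [m`_i * _]mulrC rpredM //.
by rewrite rpredX ?rpred_nat.
Qed.

(** Independence modulo q implies independence over the rationals, by descent: the coefficients of
    an integral relation are divisible by every power of q, hence vanish. Rational relations become
    integral after multiplication by a common denominator. *)
Lemma int_relation_free (q s : nat) (y : 'I_s -> K) : (1 < q)%N ->
  (forall c : 'I_s -> int, (\sum_i (c i)%:~R * y i) / q%:R \in OK ->
     forall i, (q%:Z %| c i)%Z) ->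
  (s <= \dim {:K})%N.
Proof.
move=> q1 Hq.
have q0 : q%:R != 0 :> K by rewrite rat_fieldExt_natr_eq0 -lt0n ltnW.
have int_free n (c : 'I_s -> int) : \sum_i (c i)%:~R * y i = 0 ->
    forall i, ((q ^ n)%N%:Z %| c i)%Z.
  elim: n c => [|n IH] c c0 i; first by rewrite expn0 dvd1z.
  have dq : forall i, (q%:Z %| c i)%Z by apply: Hq; rewrite c0 mul0r rpred0.
  rewrite expnSr PoszM -(divzK (dq i)) dvdz_mul2r; last by rewrite -lt0n ltnW.
  apply: (IH (fun i => (c i %/ q)%Z)).
  apply: (mulIf q0); rewrite mul0r -[RHS]c0 mulr_suml; apply: eq_bigr => j _.
  rewrite mulrAC; congr (_ * _); rewrite -[in RHS](divzK (dq j)) intrM.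
  by rewrite pmulrn.
have int_free0 : forall c : 'I_s -> int, \sum_i (c i)%:~R * y i = 0 -> forall i, c i = 0.
  move=> c c0 i; apply/eqP; rewrite -absz_eq0; apply: contraT; rewrite -lt0n => ci.
  have := int_free `|c i|%N c c0 i; rewrite dvdzE /= => /(dvdn_leq ci).
  by rewrite leqNgt ltn_expl.
have fy : free (in_tuple [seq y i | i <- enum 'I_s]).
  have sz : size [seq y i | i <- enum 'I_s] = s by rewrite size_map -cardE card_ord.
  apply/freeP => k k0 j.
  pose k' (i : 'I_s) := k (cast_ord (esym sz) i).
  have k'0 : \sum_i k' i *: y i = 0.
    rewrite -[RHS]k0 (reindex (cast_ord (esym sz))) /=; last first.
      by exists (cast_ord sz) => i _; rewrite ?cast_ordK ?cast_ordKV.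
    apply: eq_bigr => i _; congr (_ *: _).
    by rewrite (nth_map i) ?size_enum_ord // nth_ord_enum.
  pose D := \prod_i denq (k' i).
  have D0 : D != 0 by apply/prodf_neq0 => i _; apply: denq_neq0.
  have /choice[c Hc] : forall i, exists c : int, c%:~R = D%:~R * k' i :> rat.
    move=> i; exists ((\prod_(l | l != i) denq (k' l)) * numq (k' i)).
    by rewrite /D [in RHS](bigD1 i) //= !intrM numqE mulrA mulrAC [(denq _)%:~R * _]mulrC.
  have c0 : \sum_i (c i)%:~R * y i = 0.
    have : (D%:~R : rat) *: (\sum_i k' i *: y i) = 0 by rewrite k'0 scaler0.
    rewrite scaler_sumr => {2}<-; apply: eq_bigr => i _.
    by rewrite scalerA -Hc -mulr_algl -[X in _ = X * _]/(in_alg K _) rmorph_int.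
  have := Hc (cast_ord sz j); rewrite (int_free0 c c0) => /esym/eqP.
  by rewrite mulf_eq0 intr_eq0 (negPf D0) /= /k' cast_ordK => /eqP.
have sz : size [seq y i | i <- enum 'I_s] = s by rewrite size_map -cardE card_ord.
rewrite -[X in (X <= _)%N]sz.
by move: fy; rewrite /free => /eqP <-; apply/dimvS/subvf.
Qed.

(** By [int_relation_free], a family in O_K independent modulo q has at most [K:Q] members, so a
    maximal one exists. It spans O_K / q, and its combinations with coefficients in [0, q) represent
    all classes. *)
Lemma finite_mod_prime q : prime q -> exists S : seq K,
  {subset S <= OK} /\ forall x, x \in OK -> exists2 s, s \in S & (x - s) / q%:R \in OK.
Proof.
move=> pq; have q1 := prime_gt1 pq.
have q0 : q%:R != 0 :> K by rewrite rat_fieldExt_natr_eq0 -lt0n ltnW.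
pose qfree s (y : 'I_s -> K) := forall c : 'I_s -> int,
  (\sum_i (c i)%:~R * y i) / q%:R \in OK -> forall i, (q%:Z %| c i)%Z.
pose Q s := `[< exists y : 'I_s -> K, (forall i, y i \in OK) /\ qfree s y >].
have Q0 : exists s, Q s by exists 0%N; apply/asboolP; exists (fun=> 0); split=> [[]|c _ []].
have Qb s : Q s -> (s <= \dim {:K})%N.
  by move=> /asboolP[y [_ qy]]; apply: int_relation_free q1 qy.
case: (ex_maxnP Q0 Qb) => s /asboolP[y [yO yq]] smax.
exists [seq \sum_j (f j : nat)%:R * y j | f : {ffun 'I_s -> 'I_q}]; split.
  by move=> _ /mapP[f _ ->]; apply: rpred_sum => j _; rewrite rpredM ?rpred_nat.
move=> x xO.
pose y' (i : 'I_s.+1) := if unlift ord0 i is Some j then y j else x.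
have y'E c : \sum_i (c i)%:~R * y' i =
    (c ord0)%:~R * x + \sum_j (c (lift ord0 j))%:~R * y j.
  rewrite big_ord_recl /y' unlift_none; congr (_ + _).
  by apply: eq_bigr => j _; rewrite liftK.
have /existsNP[c /not_implyP[cO /existsNP[i /negP ci]]] : ~ qfree s.+1 y'.
  move=> qy'; have: Q s.+1.
    by apply/asboolP; exists y'; split=> // i; rewrite /y'; case: unliftP.
  by move=> /smax; rewrite ltnn.
rewrite y'E in cO.
have nc0 : ~~ (q%:Z %| c ord0)%Z.
  apply: contra ci => qc0.
  have cl : forall j, (q%:Z %| c (lift ord0 j))%Z.
    apply: yq; rewrite -[X in X / _](addKr ((c ord0)%:~R * x)) mulrDl rpredD //.
    rewrite mulNr rpredN -(divzK qc0) intrM -pmulrn [_ * x / _]mulrAC mulfK //.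
    by rewrite rpredM ?rpred_int.
  by case: (unliftP ord0 i) => [j|] -> //.
(* Inverting the coefficient of x modulo q expresses x as the combination of the y_j with
   coefficients m_j, then reduced to d_j in [0, q). *)
have /coprimezP[[u v] /= uv] : coprimez (c ord0) q.
  rewrite coprimezE /= coprime_sym prime_coprime //.
pose m j := - (u * c (lift ord0 j)).
pose d j := modz (m j) q.
have qz : q%:Z != 0 by rewrite -lt0n ltnW.
have d0 j : 0 <= d j by apply: modz_ge0.
have d_lt j : (`|d j|%N < q)%N.
  by rewrite -ltz_nat gez0_abs //; apply: ltz_pmod; rewrite ltz_nat ltnW.
exists (\sum_j (`|d j|%N)%:R * y j).
  apply/mapP; exists [ffun j => Ordinal (d_lt j)]; rewrite ?mem_enum //.
  by apply: eq_bigr => j _; rewrite ffunE.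
have dE j : (`|d j|%N)%:R = (m j)%:~R - (divz (m j) q)%:~R * q%:R :> K.
  have -> : (`|d j|%N)%:R = (d j)%:~R :> K by rewrite -[in RHS](gez0_abs (d0 j)).
  have -> : d j = m j - divz (m j) q * q%:Z.
    by rewrite [X in X - _](divz_eq _ q) addrAC subrr add0r.
  by rewrite rmorphB rmorphM.
have -> : (x - \sum_j (`|d j|%N)%:R * y j) / q%:R =
   u%:~R * (((c ord0)%:~R * x + \sum_j (c (lift ord0 j))%:~R * y j) / q%:R)
   + v%:~R * x + \sum_j (divz (m j) q)%:~R * y j.
  have mulqE (t A B D : K) : (t * (A / q%:R) + B + D) * q%:R = t * A + B * q%:R + D * q%:R.
    by rewrite 2!mulrDl -mulrA divfK.
  apply: (mulIf q0); rewrite divfK // mulqE.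
  have xE : x = u%:~R * ((c ord0)%:~R * x) + v%:~R * x * q%:R.
    have : u%:~R * (c ord0)%:~R + v%:~R * q%:R = 1 :> K.
      by rewrite pmulrn -!intrM -intrD uv.
    by move/(congr1 ( *%R^~ x)); rewrite mul1r => {1}<-; ring.
  rewrite [X in X - _]xE mulrDr -!addrA; congr (_ + _).
  rewrite addrCA; congr (_ + _); rewrite mulr_sumr mulr_suml -sumrN -big_split /=.
  apply: eq_bigr => j _; rewrite dE.
  have -> : (m j)%:~R = - (u%:~R * (c (lift ord0 j))%:~R) :> K.
    by rewrite /m rmorphN rmorphM.
  ring.
apply: rpredD; last by apply: rpred_sum => j _; rewrite rpredM ?rpred_int.
by apply: rpredD; apply: rpredM; rewrite ?rpred_int.
Qed.

(** Induction on N = q M with q prime: a representative modulo q plus q times a representative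
    modulo M. *)
Lemma finite_mod N : (0 < N)%N -> exists S : seq K,
  {subset S <= OK} /\ forall x, x \in OK -> exists2 s, s \in S & (x - s) / N%:R \in OK.
Proof.
elim/ltn_ind: N => N IH N0.
have [N1 | N1] := leqP N 1%N.
  have -> : N = 1%N by apply/eqP; rewrite eqn_leq N1.
  exists [:: 0]; split=> [_ /[1!inE] /eqP -> | x xO]; first exact: rpred0.
  by exists 0; rewrite ?inE // subr0 divr1.
have pq := pdiv_prime N1; have q0 := prime_gt0 pq.
have [M NE] : exists M, N = (pdiv N * M)%N.
  by exists (N %/ pdiv N)%N; rewrite mulnC divnK ?pdiv_dvd.
have M0 : (0 < M)%N by move: N0; rewrite NE muln_gt0 => /andP[].
have qK : (pdiv N)%:R != 0 :> K by rewrite rat_fieldExt_natr_eq0 -lt0n.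
have MK : M%:R != 0 :> K by rewrite rat_fieldExt_natr_eq0 -lt0n.
have [S [SO Sx]] := finite_mod_prime pq.
have [|T [TO Tx]] := IH M _ M0; first by rewrite NE ltn_Pmull ?prime_gt1.
exists [seq s + (pdiv N)%:R * t | s <- S, t <- T]; split.
  by move=> _ /allpairsP[[s t] /= [sS tT ->]]; rewrite rpredD ?rpredM ?rpred_nat ?(SO _ sS) ?(TO _ tT).
move=> x /Sx[s sS /Tx[t tT xst]].
exists (s + (pdiv N)%:R * t); first by apply/allpairsP; exists (s, t).
rewrite [X in _ / X%:R \in _]NE natrM invfM mulrA opprD addrA mulrBl [(pdiv N)%:R * t]mulrC mulfK //.
Qed.

Lemma pigeonhole_mod N (u : nat -> K) : (0 < N)%N -> (forall i, u i \in OK) ->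
  exists i j : nat, (i < j)%N /\ (u j - u i) / N%:R \in OK.
Proof.
move=> N0 uO; have [S [SO Sx]] := finite_mod N0.
have /choice[f Hf] : forall i, exists s, s \in S /\ (u i - s) / N%:R \in OK.
  by move=> i; have [s] := Sx _ (uO i); exists s.
have : ~~ uniq [seq f i | i <- iota 0 (size S).+1].
  apply/negP => /uniq_leq_size/(_ (_ : {subset _ <= S})).
  rewrite size_map size_iota ltnn => H; suff : false by []; apply: H.
  by move=> _ /mapP[i _ ->]; case: (Hf i).
move=> /(uniqPn 0)[i [j [ij]]]; rewrite size_map size_iota => jS.
have iS := ltn_trans ij jS.
rewrite !(nth_map 0%N) ?size_iota // !nth_iota // !add0n => fij.
exists i, j; split=> //.
rewrite (_ : u j - u i = (u j - f j) - (u i - f i)); last first.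
  by rewrite fij opprB addrA subrK.
by rewrite mulrBl rpredB //; case: (Hf i) (Hf j) => [_ ?] [].
Qed.

(** Two of the N y^k agree modulo N, so y^j - y^i is integral for some i < j, and y is a root of the
    monic X^j - X^i - (y^j - y^i). *)
Lemma almost_integral N y : (0 < N)%N -> (forall k, N%:R * y ^+ k \in OK) -> y \in OK.
Proof.
move=> N0 HN; have [i [j [ij]]] := pigeonhole_mod N0 HN.
rewrite -mulrBr mulrAC divff ?mul1r ?rat_fieldExt_natr_eq0 -?lt0n // => yO.
apply: (@monic_root_algint _ _ ('X ^+ j - 'X ^+ i - (y ^+ j - y ^+ i)%:P)).
- have s1 : (size ('X ^+ i + (y ^+ j - y ^+ i)%:P)%R < size ('X ^+ j : {poly K}))%N.
    rewrite size_polyXn ltnS (leq_trans (size_polyD _ _)) // geq_max size_polyXn ij /=.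
    by rewrite (leq_trans (size_polyC_leq1 _)) // (leq_trans _ ij).
  by rewrite -addrA -opprD monicE lead_coefDl ?size_polyN // lead_coefXn.
- by rewrite /root !hornerE subrr.
- move=> k; rewrite !coefB !coefXn coefC.
  by rewrite !rpredB ?rpred_nat //; case: eqP => // _; rewrite rpred0.
Qed.
End NumberField.

(** * Prime ideals of O_K: local inverses, and the radical of p O_K *)

Section Ideals.
Variable K : fieldExtType rat.
Local Notation OK := (algint (aspacef K)).

Definition toO x (xO : x \in OK) : 'O K := Sub x xO.

Lemma val_toO x (xO : x \in OK) : val (toO xO) = x.
Proof. exact: SubK. Qed.

Lemma count_subset_eq (T : eqType) (P Q : pred T) (s : seq T) :
  subpred P Q -> (count Q s <= count P s)%N -> {in s, forall x, Q x -> P x}.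
Proof.
move=> PQ; elim: s => // x s IH /= le; have le1 := sub_count PQ s.
case: (boolP (P x)) le => [Px | nPx]; first rewrite (PQ _ Px) leq_add2l => /IH le.
  by move=> z /[1!inE] /predU1P[-> | /le].
case: (boolP (Q x)) => [_ | nQx]; first by rewrite ltnNge le1.
by move=> /IH le z /[1!inE] /predU1P[-> | /le //]; rewrite (negPf nQx).
Qed.

(* Among the multiples t y outside O_K, those with the largest annihilator
   modulo O_K have a prime annihilator. *)
Lemma prime_annihilator N y : (0 < N)%N -> y \notin OK -> N%:R * y \in OK ->
  exists t, [/\ t \in OK, t * y \notin OK &
    forall a b, a \in OK -> b \in OK -> a * b * (t * y) \in OK ->
      a * (t * y) \in OK \/ b * (t * y) \in OK].
Proof.
move=> N0 yO NyO; have [S [SO Sx]] := finite_mod K N0.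
(* The annihilator of t y modulo O_K contains N, so it is a union of classes modulo N; its size is
   measured by the representatives it contains. *)
pose f t := count (fun s => s * (t * y) \in OK) S.
pose Q n := `[< exists t, [/\ t \in OK, t * y \notin OK & f t = n] >].
have Q0 : exists n, Q n.
  by exists (f 1); apply/asboolP; exists 1; rewrite rpred1 mul1r.
have Qb n : Q n -> (n <= size S)%N by move=> /asboolP[t [_ _ <-]]; apply: count_size.
case: (ex_maxnP Q0 Qb) => n /asboolP[t [tO tyO ftn]] nmax.
exists t; split=> // a b aO bO abO.
case: (boolP (a * (t * y) \in OK)) => [|aty]; [by left | right].
have QaT : Q (f (a * t)) by apply/asboolP; exists (a * t); rewrite rpredM // -mulrA.
have le := nmax _ QaT; rewrite -ftn in le.
(* The annihilator of a t y contains that of t y and by maximality has no more representatives. So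
   the two coincide, and b belongs to the first. *)
have sub : subpred (fun s => s * (t * y) \in OK) (fun s => s * (a * t * y) \in OK).
  by move=> s /= sO; rewrite -[a * t * y]mulrA mulrCA rpredM.
have [s sS bs] := Sx _ bO.
have N0K : N%:R != 0 :> K by rewrite rat_fieldExt_natr_eq0 -lt0n.
have bsE : b = s + (b - s) / N%:R * N%:R by rewrite divfK // addrC subrK.
have NO c : c \in OK -> (b - s) / N%:R * N%:R * (c * y) \in OK.
  move=> cO; rewrite (_ : _ * (c * y) = (b - s) / N%:R * c * (N%:R * y)); last by ring.
  by apply: rpredM => //; apply: rpredM.
rewrite bsE mulrDl rpredD ?NO //.
apply: (count_subset_eq sub le) => //=.
rewrite -[X in X * _](addrK ((b - s) / N%:R * N%:R)) -bsE mulrBl rpredB //.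
  by rewrite (_ : b * _ = a * b * (t * y)) //; ring.
by rewrite NO // rpredM.
Qed.

(** By pigeonhole the powers of x repeat modulo N. *)
Lemma pow_congr N (x : 'O K) : (0 < N)%N ->
  exists i j : nat, exists2 w : 'O K, (0 < j)%N & x ^+ i * (x ^+ j - 1) = N%:R * w.
Proof.
move=> N0; have [|i [j [ij wO]]] := @pigeonhole_mod K N (fun k => val x ^+ k) N0.
  by move=> k; rewrite rpredX // (valP x).
exists i, (j - i)%N, (toO wO); first by rewrite subn_gt0.
have N0K : N%:R != 0 :> K by rewrite rat_fieldExt_natr_eq0 -lt0n.
rewrite mulrBr -exprD subnKC 1?ltnW // mulr1.
by apply: val_inj; rewrite rmorphB rmorphM !rmorphXn rmorph_nat /= ?val_toO [RHS]mulrC divfK.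
Qed.

Lemma finite_mod_O N : (0 < N)%N -> exists S : seq ('O K),
  forall x, exists2 s, s \in S & exists w, x = s + N%:R * w.
Proof.
move=> N0; have [S [SO Sx]] := finite_mod K N0.
exists (pmap (insub : K -> option ('O K)) S) => x.
have N0K : N%:R != 0 :> K by rewrite rat_fieldExt_natr_eq0 -lt0n.
have [s sS xs] := Sx _ (valP x); exists (toO (SO _ sS)).
  by rewrite mem_pmap_sub.
exists (toO xs); apply: val_inj.
by rewrite rmorphD rmorphM rmorph_nat /= ?val_toO [_%:R * _]mulrC divfK // addrC subrK.
Qed.

Section Prime.
Variable P : prime_idealr ('O K).

Lemma primeN1 : 1 \notin P.
Proof. by rewrite idealr1. Qed.

Lemma primeMl x u : u \in P -> x * u \in P.
Proof. by move=> uP; rewrite prime_idealrM uP orbT. Qed.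

Lemma primeX x n : x ^+ n \in P -> x \in P.
Proof.
elim: n => [|n IH]; first by rewrite expr0 (negPf primeN1).
by rewrite exprS prime_idealrM => /orP[].
Qed.

Lemma nonzero_prime_nat : nonzero_ideal P -> exists2 N : nat, (0 < N)%N & N%:R \in P.
Proof.
move=> [x xP x0]; have [N N0 NO] := clear_denominator (val x)^-1; exists N => //.
have -> : N%:R = toO NO * x :> 'O K.
  by apply: val_inj; rewrite rmorphM rmorph_nat /= ?val_toO mulfVK.
exact: primeMl.
Qed.

Section Residue.
Variable N : nat.
Hypotheses (N0 : (0 < N)%N) (NP : N%:R \in P).

(** The powers of u repeat modulo N, hence modulo the prime P, so u^j = 1 modulo P for some j > 0
    and u^(j-1) is an inverse. *)
Lemma residue_inverse u : u \notin P -> exists r, 1 - r * u \in P.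
Proof.
move=> uP; have [i [j [w j0 E]]] := pow_congr u N0.
have : u ^+ i * (u ^+ j - 1) \in P by rewrite E mulrC primeMl.
rewrite prime_idealrM => /orP[/primeX | ]; first by rewrite (negPf uP).
by exists (u ^+ j.-1); rewrite -exprSr prednK // -rpredN opprB.
Qed.

(** Were y P contained in P, all N y^k would lie in P, and y would be almost integral, hence
    integral. *)
Lemma not_stable y : y \notin OK -> (forall v, v \in P -> y * val v \in OK) ->
  exists v u : 'O K, [/\ v \in P, u \notin P & y * val v = val u].
Proof.
move=> yO yP; apply: contrapT => H.
have st v (vP : v \in P) : toO (yP v vP) \in P.
  by apply: contraT => uP; case: H; exists v, (toO (yP v vP)); rewrite val_toO.
suff H1 k : exists2 v, v \in P & val v = N%:R * y ^+ k.
  by case/negP: yO; apply: (almost_integral N0) => k; have [v _ <-] := H1 k; apply: valP.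
elim: k => [|k [v vP vE]]; first by exists N%:R; rewrite // rmorph_nat expr0 mulr1.
by exists (toO (yP v vP)); rewrite // val_toO vE exprS mulrCA.
Qed.

(** The elements of P are nilpotent, with a common exponent, in the localization at P of the finite
    ring O_K / N; e is the denominator that localization allows. The proof adds one class modulo N
    at a time. *)
Lemma prime_nilpotent : exists2 e, e \notin P &
  exists k, forall x, x \in P -> exists w, e * x ^+ k = N%:R * w.
Proof.
have [S HS] := finite_mod_O N0.
suff [e eP [k Hk]] : exists2 e, e \notin P & exists k, forall x, x \in P ->
    (exists2 s, s \in S & exists w, x = s + N%:R * w) -> exists w, e * x ^+ k = N%:R * w.
  by exists e => //; exists k => x xP; apply: Hk.
elim: S {HS} => [|s S [e eP [k Hk]]]; first by exists 1; rewrite ?primeN1 //; exists 0%N => x _ [].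
have [[x0 [x0P [w0 x0E]]] | nx0] :=
  pselect (exists x0, x0 \in P /\ exists w, x0 = s + N%:R * w); last first.
  exists e => //; exists k => x xP [s' /[1!inE] /predU1P[-> xE | s'S xE]].
    by case: nx0; exists x.
  by apply: Hk => //; exists s'.
(* As x0 is in P, x0^j - 1 is not. Taken as a factor of e, it sends x0^i, hence x^i for every x in
   the class of s, into N O_K. *)
have [i [j [w1 j0 E]]] := pow_congr x0 N0.
have e0P : x0 ^+ j - 1 \notin P.
  apply/negP => H; case/negP: primeN1.
  by rewrite -[1](subKr (x0 ^+ j)) rpredB // -(prednK j0) exprSr primeMl.
exists (e * (x0 ^+ j - 1)); first by rewrite prime_idealrM negb_or eP.
exists (k + i)%N => x xP [s' /[1!inE] /predU1P[-> [w xE] | s'S xE]].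
  have [w2 xiE] : exists w2, x ^+ i = x0 ^+ i + N%:R * w2.
    rewrite (_ : x = x0 + N%:R * (w - w0)); last by rewrite xE x0E; ring.
    elim: (i) => [|n [w2 IH]]; first by exists 0; rewrite mulr0 addr0.
    rewrite exprS IH.
    by exists ((w - w0) * (x0 ^+ n + N%:R * w2) + x0 * w2); rewrite exprS; ring.
  exists (e * x ^+ k * (w1 + w2 * (x0 ^+ j - 1))).
  rewrite exprD xiE [LHS](_ : _ = e * x ^+ k * (x0 ^+ i * (x0 ^+ j - 1)) +
      N%:R * (e * x ^+ k * (w2 * (x0 ^+ j - 1)))); last by ring.
  by rewrite E; ring.
have [|w wE] := Hk _ xP; first by exists s'.
exists (w * (x0 ^+ j - 1) * x ^+ i).
by rewrite exprD mulrACA [_ * x ^+ i]mulrC mulrCA wE; ring.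
Qed.

End Residue.

(** Locally at P, y generates the inverse of P. It is a multiple of e / N, with e from
    [prime_nilpotent], whose annihilator modulo O_K is prime; a power of each v in P annihilates it,
    hence so does v. Then [not_stable] applies. *)
Lemma prime_invertible : nonzero_ideal P -> exists y : K,
  (forall v, v \in P -> y * val v \in OK) /\
  exists v u : 'O K, [/\ v \in P, u \notin P & y * val v = val u].
Proof.
move=> /nonzero_prime_nat[N N0 NP].
have [e eP [k Hk]] := prime_nilpotent N0.
have N0K : N%:R != 0 :> K by rewrite rat_fieldExt_natr_eq0 -lt0n.
have yO : val e / N%:R \notin OK.
  apply/negP => eO; case/negP: eP; rewrite (_ : e = toO eO * N%:R) ?primeMl //.
  by apply: val_inj; rewrite rmorphM rmorph_nat /= ?val_toO divfK.
have [|t [tO tyO tprime]] := prime_annihilator N0 yO.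
  by rewrite mulrC divfK ?(valP e).
pose y := t * (val e / N%:R); exists y.
have yP v : v \in P -> y * val v \in OK.
  move=> vP; rewrite mulrC.
  have : val v ^+ k * y \in OK.
    have [w wE] := Hk _ vP; move/(congr1 val): wE.
    rewrite !rmorphM rmorphXn rmorph_nat /= => wE.
    rewrite (_ : _ * y = t * val w); first by rewrite rpredM ?(valP w).
    rewrite [LHS](_ : _ = t * (val e * val v ^+ k) / N%:R); last by rewrite /y; ring.
    by rewrite wE mulrCA mulrC mulKf.
  elim: k {Hk} => [|n IH]; first by rewrite expr0 mul1r (negPf tyO).
  by rewrite exprS => H; have [//|/IH] := tprime _ _ (valP v) (rpredX n (valP v)) H.
by split=> //; apply: (not_stable N0).
Qed.

End Prime.

(** Of the class of y in K / O_K. *)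
Definition annihilator (y : K) : {pred 'O K} := fun x => val x * y \in OK.

Lemma ideal_pow1 (P : {pred 'O K}) x : x \in P -> ideal_pow P 1 x.
Proof.
move=> xP; exists [:: (x, 1)]; rewrite big_seq1 mulr1; split=> // _ /[1!inE] /eqP -> //.
Qed.

(** A nilpotent class modulo p would yield m1 outside p O_K with m1^2 in p O_K. Let P be the prime
    annihilator of a suitable y = t m1 / p modulo O_K. It contains p and m1, and y P is not
    contained in P; this forces p into P^2. *)
Lemma unramified_radical p n (m : 'O K) : (0 < p)%N -> unramified_in p K ->
  (exists w, m ^+ n = p%:R * w) -> exists w, m = p%:R * w.
Proof.
move=> p0 unr [w0 w0E]; apply: contrapT => ndvd.
have exn : exists n, `[< exists w, m ^+ n = p%:R * w >] by exists n; apply/asboolP; exists w0.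
case: (ex_minnP exn) => -[|[|l]] /asboolP[w wE] lmin.
- by apply: ndvd; exists (w * m); rewrite mulrA -wE mul1r.
- by apply: ndvd; exists w; rewrite -wE.
have [m1 m1E] : exists m1, m1 = m ^+ l.+1 by exists (m ^+ l.+1).
have [w1 w1E] : exists w1, m1 * m1 = p%:R * w1.
  by exists (w * m ^+ l); rewrite mulrA -wE m1E -!exprD addSnnS addnC.
have nm1 : ~ exists w, m1 = p%:R * w.
  by rewrite m1E => /asboolP/lmin; rewrite ltnn.
have p0K : p%:R != 0 :> K by rewrite rat_fieldExt_natr_eq0 -lt0n.
have yO : val m1 / p%:R \notin OK.
  apply/negP => mO; apply: nm1; exists (toO mO).
  by apply: val_inj; rewrite rmorphM rmorph_nat /= ?val_toO mulrC divfK.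
have [|t [tO tyO tprime]] := prime_annihilator p0 yO.
  by rewrite mulrC divfK ?(valP m1).
pose y := t * (val m1 / p%:R).
have annE x : (x \in annihilator y) = (val x * y \in OK) by [].
have idP : idealr_closed (annihilator y).
  split; rewrite ?annE; first by rewrite rmorph0 mul0r rpred0.
    by rewrite rmorph1 mul1r.
  move=> a u v; rewrite !annE rmorphD rmorphM => uO vO.
  by rewrite mulrDl rpredD // -mulrA rpredM ?(valP a).
have prP : prime_idealr_closed (annihilator y).
  move=> a b; rewrite !annE rmorphM.
  by move=> /(tprime _ _ (valP a) (valP b))[] ->; rewrite ?orbT.
have [P PE] : exists P : prime_idealr ('O K), forall x, (x \in P) = (val x * y \in OK).
  pose P : prime_idealr ('O K) := HB.pack (annihilator y)
    (isIdealr.Build _ _ idP) (isPrimeIdealrClosed.Build _ _ prP).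
  by exists P.
have pP : p%:R \in P.
  by rewrite PE rmorph_nat /y mulrCA [p%:R * _]mulrC divfK // rpredM ?(valP m1).
apply: (unr P pP).
have m1P : m1 \in P.
  rewrite PE (_ : _ * y = t * val w1) ?rpredM ?(valP w1) //.
  have {}w1E : val m1 * val m1 = p%:R * val w1 by rewrite -rmorphM w1E rmorphM rmorph_nat.
  by rewrite /y mulrCA; congr (t * _); rewrite mulrA w1E mulrAC mulfV ?mul1r.
have [|v [u [vP uP uE]]] := not_stable p0 pP tyO.
  by move=> v; rewrite PE mulrC.
have [r rP] := residue_inverse p0 pP uP.
(* Since u p = t m1 v, p is r t m1 v + (1 - r u) p, a sum of two products of elements of P. *)
exists [:: (r * toO tO * m1, v); (1 - r * u, p%:R)]; split.
  move=> z /[!inE] /pred2P[] ->; split=> //; try exact: ideal_pow1.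
  exact: primeMl.
rewrite big_cons big_seq1 /=.
have ypE : y * p%:R = t * val m1 by rewrite /y -mulrA divfK.
have uE' : val (u * p%:R) = val (toO tO * m1 * v).
  rewrite !rmorphM rmorph_nat -[X in X * _ = _]uE mulrAC ypE.
  by congr (_ * _ * _); rewrite val_toO.
by rewrite -[r * _ * m1]mulrA -[r * _ * v]mulrA -(val_inj uE'); ring.
Qed.

End Ideals.

(** * Sums of roots of unity, nilpotents and Frobenius modulo q, integers of E *)

Lemma prim_root_sum (F : fieldType) n (z : F) j : n.-primitive_root z ->
  \sum_(k < n) z ^+ (j * k) = if (n %| j)%N then n%:R else 0.
Proof.
move=> zn; case: ifP => nj.
  rewrite (eq_bigr (fun=> 1)) ?sumr_const ?card_ord // => k _.
  by rewrite exprM (eqP (_ : z ^+ j == 1)) ?expr1n // -(prim_order_dvd zn).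
have zj : z ^+ j - 1 != 0 by rewrite subr_eq0 -(prim_order_dvd zn) nj.
apply: (mulfI zj); rewrite mulr0 (eq_bigr (fun k : 'I_n => (z ^+ j) ^+ k)).
  by rewrite -subrX1 exprAC (prim_expr_order zn) expr1n subrr.
by move=> k _; rewrite exprM.
Qed.

Section NilpotentModulo.
Variables (R : comNzRingType) (S : subringClosed R) (q : R).

(** For x in S, nilpotence in the quotient S / q S. *)
Definition nil_mod x := exists n w, w \in S /\ x ^+ n = q * w.

Lemma nil_modD x y : x \in S -> y \in S -> nil_mod x -> nil_mod y -> nil_mod (x + y).
Proof.
move=> xS yS [m [w [wS wE]]] [n [w' [w'S w'E]]]; exists (m + n)%N.
have big (z w1 : R) k l : z \in S -> w1 \in S -> z ^+ k = q * w1 -> (k <= l)%N ->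
    exists2 w2, w2 \in S & z ^+ l = q * w2.
  move=> zS w1S E kl; exists (w1 * z ^+ (l - k)); first by rewrite rpredM ?rpredX.
  by rewrite mulrA -E -exprD subnKC.
rewrite exprDn; apply: (big_ind (fun z => exists w, w \in S /\ z = q * w)) => [|u v [wu [wuS ->]] [wv [wvS ->]]|i _].
- by exists 0; rewrite rpred0 mulr0.
- by exists (wu + wv); rewrite rpredD // mulrDr.
have [ni | mi] := leqP n i.
  have [w2 w2S ->] := big _ _ _ _ yS w'S w'E ni.
  exists (x ^+ (m + n - i) * w2 *+ 'C(m + n, i)).
  by split; [rewrite rpredMn ?rpredM ?rpredX | rewrite mulrnAr mulrCA].
have mi' : (m <= m + n - i)%N by rewrite -addnBA ?leq_addr // ltnW.
have [w2 w2S ->] := big _ _ _ _ xS wS wE mi'.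
exists (w2 * y ^+ i *+ 'C(m + n, i)).
by split; [rewrite rpredMn ?rpredM ?rpredX | rewrite mulrnAr mulrA].
Qed.

Lemma nil_mod_sum I (r : seq I) (F : I -> R) :
  (forall i, F i \in S) -> (forall i, nil_mod (F i)) -> nil_mod (\sum_(i <- r) F i).
Proof.
move=> FS Fn; suff [] : \sum_(i <- r) F i \in S /\ nil_mod (\sum_(i <- r) F i) by [].
elim/big_rec: _ => [|i x _ [xS xn]]; last by rewrite rpredD //; split=> //; apply: nil_modD.
by rewrite rpred0; split=> //; exists 1%N, 0; rewrite rpred0 mulr0.
Qed.

End NilpotentModulo.

Lemma frobenius_mod (R : comNzRingType) (S : subringClosed R) p x y :
  prime p -> x \in S -> y \in S ->
  exists2 w, w \in S & (x + y) ^+ p = x ^+ p + y ^+ p + p%:R * w.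
Proof.
case: p => [//|p] pp xS yS.
exists (\sum_(i < p) x ^+ (p - i) * y ^+ i.+1 *+ ('C(p.+1, i.+1) %/ p.+1)).
  by apply: rpred_sum => i _; rewrite rpredMn ?rpredM ?rpredX.
rewrite exprDn big_ord_recl big_ord_recr /= /bump /= !add1n subn0 subnn bin0 binn.
rewrite expr0 mulr1 mul1r !mulr1n addrA addrAC; congr (_ + _).
rewrite mulr_sumr; apply: eq_bigr => i _; rewrite /bump /= add1n subSS.
by rewrite mulr_natl -mulrnA divnK // prime_dvd_bin //= ltnS ltn_ord.
Qed.

Section AlgebraicIntegers.
Variables (K : fieldExtType rat) (E : splittingFieldType K).
Local Notation OE := (algint {:E}%AS).
Local Notation OK := (algint (aspacef K)).

Lemma natrE_eq0 n : (n%:R == 0 :> E) = (n == 0)%N.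
Proof. by rewrite fieldExt_natr_eq0 rat_fieldExt_natr_eq0. Qed.

Lemma algintE (U : {subfield E}) x : (x \in algint U) = (x \in U) && (x \in OE).
Proof.
apply/idP/andP => [/algintP[xU xi] | [xU /algintfP xi]]; last exact/algintP.
by split=> //; apply/algintfP.
Qed.

Lemma algint_alg (m : K) : (m%:A \in OE) = (m \in OK).
Proof.
apply/idP/idP => [/algintfP[q mq] | mO]; last exact: (@algint_inA _ _ _ (toO mO)).
have -> : map_poly (intr : int -> E) q = map_poly (in_alg E) (map_poly (intr : int -> K) q).
  rewrite -map_poly_comp; apply: eq_map_poly => i; exact/esym/(rmorph_int (in_alg E)).
rewrite -[_%:A]/(in_alg E m) fmorph_root => qm.
by apply/algintfP; exists q.
Qed.

Lemma algint_gal (g : gal_of {:E}) x : x \in OE -> g x \in OE.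
Proof.
move=> /algintfP[q mq qx]; apply/algintfP; exists q => //.
have -> : map_poly (intr : int -> E) q = map_poly g (map_poly intr q).
  by rewrite -map_poly_comp; apply: eq_map_poly => i; exact/esym/rmorph_int.
by rewrite fmorph_root.
Qed.

Lemma algint_root1 n z : (0 < n)%N -> z ^+ n = 1 -> z \in OE.
Proof.
move=> n0 zn; apply: (@monic_root_algint _ _ ('X ^+ n - 1%:P)).
- by rewrite monicXnsubC.
- by rewrite /root !hornerE zn subrr.
- by move=> i; rewrite coefB coefXn coefC; case: (i == 0)%N; rewrite rpredB ?rpred_nat ?rpred1 ?rpred0.
Qed.

End AlgebraicIntegers.

(** * Traces and coordinates of the integers of L on the powers of alpha *)

Section Kummer.
Variables (K : fieldExtType rat) (E : splittingFieldType K).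
Variables (p : nat) (alpha zeta : E) (a : 'O K) (sigma : gal_of {:E}).
Hypotheses (p_prime : prime p) (zeta_prim : p.-primitive_root zeta).
Hypothesis dimL : \dim <<1; alpha>> = p.
Hypotheses (alphaO : alpha \in algint <<1; alpha>>%AS) (alphaP : alpha ^+ p = (val a)%:A).
Hypotheses (sigma_alpha : sigma alpha = zeta * alpha) (sigma_zeta : sigma zeta = zeta).

Local Notation L := <<1; alpha>>%AS.
Local Notation OE := (algint {:E}%AS).
Local Notation OK := (algint (aspacef K)).

Let p0 : (0 < p)%N := prime_gt0 p_prime.

Lemma pE0 : p%:R != 0 :> E.
Proof. by rewrite natrE_eq0 -lt0n. Qed.

Lemma alpha_int : alpha \in OE.
Proof. by move: alphaO; rewrite algintE => /andP[]. Qed.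

Lemma alphaL : alpha \in L.
Proof. exact: memv_adjoin. Qed.

Lemma alpha_neq0 : alpha != 0.
Proof.
apply/eqP => alpha0; move: dimL; rewrite alpha0 Fadjoin0 dimv1 => p1.
by move: p_prime; rewrite -p1.
Qed.

Lemma a_neq0 : a != 0.
Proof.
apply/eqP => a0; move: (expf_neq0 p alpha_neq0).
by rewrite alphaP a0 rmorph0 scale0r eqxx.
Qed.

Lemma sigmaX_alpha k : (sigma ^+ k)%g alpha = zeta ^+ k * alpha.
Proof.
elim: k => [|k IH]; first by rewrite expg0 gal_id expr0 mul1r.
by rewrite expgSr galM ?memvf // IH rmorphM rmorphXn /= sigma_zeta sigma_alpha mulrA -exprSr.
Qed.

Lemma sigmaX_zeta k : (sigma ^+ k)%g zeta = zeta.
Proof.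
elim: k => [|k IH]; first by rewrite expg0 gal_id.
by rewrite expgSr galM ?memvf // IH.
Qed.

Lemma gal_alg (g : gal_of {:E}) (m : K) : g m%:A = m%:A.
Proof. by rewrite linearZ rmorph1. Qed.

(** Coordinates are sequences, of which only the values below p count. *)
Definition Lcomb (m : nat -> K) : E := \sum_(j < p) m j *: alpha ^+ j.

Lemma LcombP x : x \in L -> exists m, x = Lcomb m.
Proof.
move=> xL; set q := Fadjoin_poly 1 alpha x.
have sq : (size q <= p)%N.
  have := size_Fadjoin_poly 1%AS alpha x; have := dim_Fadjoin 1%AS alpha.
  by rewrite dimv1 muln1 dimL => <-.
have /choice[m mE] : forall j, exists c : K, q`_j = c%:A.
  by move=> j; apply/vlineP/polyOverP/Fadjoin_polyOver.
exists m; rewrite -{1}(Fadjoin_poly_eq xL) -/q (horner_coef_wide _ sq).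
by apply: eq_bigr => j _; rewrite mE mulr_algl.
Qed.

Lemma Lcomb_mem m : Lcomb m \in L.
Proof. by apply: rpred_sum => j _; rewrite rpredZ ?rpredX ?alphaL. Qed.

Lemma sigmaX_Lcomb k m :
  (sigma ^+ k)%g (Lcomb m) = \sum_(j < p) m j *: (zeta ^+ (j * k) * alpha ^+ j).
Proof.
rewrite rmorph_sum; apply: eq_bigr => j _ /=.
by rewrite linearZ /= rmorphXn /= sigmaX_alpha exprMn -exprM mulnC.
Qed.

(** On L this is the trace to K: the sigma^k restrict to the p embeddings of L. *)
Definition Ltrace x := \sum_(k < p) (sigma ^+ k)%g x.

(** The sum over k of zeta^((j+i)k) vanishes unless p divides j + i. *)
Lemma Ltrace_shift m i : Ltrace (Lcomb m * alpha ^+ i) =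
  \sum_(j < p | (p %| j + i)%N) (p%:R * m j) *: alpha ^+ (j + i).
Proof.
have E1 k : (sigma ^+ k)%g (Lcomb m * alpha ^+ i) =
    \sum_(j < p) zeta ^+ ((j + i) * k) * (m j *: alpha ^+ (j + i)).
  rewrite rmorphM rmorphXn /= sigmaX_Lcomb sigmaX_alpha mulr_suml.
  apply: eq_bigr => j _; rewrite exprMn -exprM [(k * i)%N]mulnC mulnDl !exprD.
  by rewrite -!scalerAl -scalerAr mulrACA.
rewrite /Ltrace (eq_bigr _ (fun (k : 'I_p) _ => E1 k)) exchange_big /= [RHS]big_mkcond.
apply: eq_bigr => j _; rewrite -mulr_suml (prim_root_sum _ zeta_prim).
by case: ifP; rewrite ?mul0r // -scalerA mulr_natl scaler_nat.
Qed.

Lemma Ltrace0 m : Ltrace (Lcomb m) = (p%:R * m 0%N)%:A.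
Proof.
rewrite -[Lcomb m]mulr1 -[1 in X in Ltrace X](expr0 alpha) Ltrace_shift.
rewrite (big_pred1 (Ordinal p0)) /= ?addn0 ?expr0 // => j.
rewrite addn0 /=; apply/idP/eqP => [pj | -> //]; apply: val_inj => /=.
case: (posnP j) => // j0; by have := dvdn_leq j0 pj; rewrite leqNgt ltn_ord.
Qed.

(** Up to the factor p a, alpha^(p-j) is dual to alpha^j for the trace form. *)
Lemma Ltrace_dual m j : (0 < j < p)%N ->
  Ltrace (Lcomb m * alpha ^+ (p - j)) = (p%:R * val a * m j)%:A.
Proof.
move=> /andP[j0 jp]; rewrite Ltrace_shift (big_pred1 (Ordinal jp)) /= => [|k].
  by rewrite subnKC 1?ltnW // alphaP scalerA mulrAC.
apply/idP/eqP => [/dvdnP[q qE] | ->]; last by rewrite /= subnKC // ltnW.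
apply: val_inj => /=; have kp := ltn_ord k; case: q qE => [|[|q]] qE; move: qE; rewrite ?mul0n ?mul1n ?mulSn; lia.
Qed.

Lemma Ltrace_int x : x \in OE -> Ltrace x \in OE.
Proof. by move=> xO; apply: rpred_sum => k _; apply: algint_gal. Qed.

(* A nilpotent element modulo q has a nilpotent trace modulo q. *)
Lemma Ltrace_nil (q : 'O K) x n w : q != 0 -> x \in OE -> w \in OE ->
  x ^+ n = (val q)%:A * w -> forall t : 'O K, Ltrace x = (val t)%:A ->
  exists l (w : 'O K), t ^+ l = q * w.
Proof.
move=> q0 xO wO xn t tE.
have [i|i|l [v [vO vE]]] := @nil_mod_sum _ OE (val q)%:A _ (index_enum 'I_p) (fun k => (sigma ^+ k)%g x).
- exact: algint_gal.
- exists n, ((sigma ^+ i)%g w); split; first exact: algint_gal.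
  by rewrite -rmorphXn xn rmorphM /= gal_alg.
move: vE; rewrite -/(Ltrace x) tE => vE.
have qK : val q != 0 by [].
have qE : (val q)%:A != 0 :> E by rewrite scaler_eq0 (negPf qK) oner_eq0.
have vEK : v = (val t ^+ l / val q)%:A.
  apply: (mulfI qE); rewrite -vE mulr_algl scalerA mulrCA mulfV // mulr1.
  by rewrite -[RHS]in_algE rmorphXn.
move: vO; rewrite vEK algint_alg => vO; exists l, (toO vO).
apply: val_inj; rewrite rmorphXn rmorphM.
by rewrite [X in _ = _ * X]val_toO mulrCA mulfV ?mulr1.
Qed.

Lemma coef0_int m : Lcomb m \in OE -> p%:R * m 0%N \in OK.
Proof. by move/Ltrace_int; rewrite Ltrace0 algint_alg. Qed.

Lemma coef_dual_int m j : (0 < j < p)%N -> Lcomb m \in OE -> p%:R * val a * m j \in OK.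
Proof.
move=> jp mO; rewrite -(@algint_alg _ E) -Ltrace_dual //.
by apply: Ltrace_int; rewrite rpredM ?rpredX ?alpha_int.
Qed.

Lemma Lcomb_inj m m' : Lcomb m = Lcomb m' -> forall j, (j < p)%N -> m j = m' j.
Proof.
have pK : p%:R != 0 :> K by rewrite rat_fieldExt_natr_eq0 -lt0n.
have aK : val a != 0 := a_neq0.
move=> mm' [_ | j jp].
  apply: (mulfI pK); suff : (p%:R * m 0%N)%:A = (p%:R * m' 0%N)%:A :> E.
    exact: (fmorph_inj (in_alg E)).
  by rewrite -!Ltrace0 mm'.
apply: (mulfI (mulf_neq0 pK aK)).
suff : (p%:R * val a * m j.+1)%:A = (p%:R * val a * m' j.+1)%:A :> E.
  exact: (fmorph_inj (in_alg E)).
by rewrite -!Ltrace_dual // mm'.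
Qed.

Variable b : 'O K.
Hypothesis aE : a = 1 + p%:R ^+ 2 * b.

Let bE : (val a)%:A = 1 + p%:R ^+ 2 * (val b)%:A :> E.
Proof.
have -> : val a = 1 + p%:R ^+ 2 * val b.
  by rewrite aE rmorphD rmorphM rmorphXn rmorph_nat rmorph1.
by rewrite -[LHS]in_algE rmorphD rmorphM rmorphXn rmorph_nat rmorph1.
Qed.

(** Call the element x. Then x (alpha - 1) = (a - 1) / p = p b, so alpha x = x + p b. The p-th power
    of this is (1 + p^2 b) x^p = (x + p b)^p; cancelling x^p and dividing by p^2 b leaves a monic
    integral equation for x. *)
Lemma geometric_int : p%:R^-1 * \sum_(j < p) alpha ^+ j \in algint L.
Proof.
rewrite algintE; apply/andP; split.
  rewrite rpredM ?rpred_sum // => [|j _]; last by rewrite rpredX ?alphaL.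
  by rewrite rpredV rpred_nat.
set x := _ * _; set c := (val b)%:A : E.
have cO : c \in OE by rewrite algint_alg (valP b).
have xb : x * (alpha - 1) = p%:R * c.
  apply: (mulfI pE0); rewrite mulrA mulVKf ?pE0 // mulrC -subrX1 alphaP bE.
  by rewrite addrAC subrr add0r expr2 mulrA.
have [-> | x0] := eqVneq x 0; first by rewrite rpred0.
have alpha1 : alpha - 1 != 0.
  apply/eqP => /eqP; rewrite subr_eq0 => /eqP alpha1; move: dimL p_prime.
  by rewrite alpha1 (Fadjoin_idP _) ?rpred1 // dimv1 => <-.
have c0 : c != 0.
  by apply: contra_neq (mulf_neq0 x0 alpha1) => c0; rewrite xb c0 mulr0.
have d0 : p%:R ^+ 2 * c != 0 by rewrite mulf_neq0 // expf_neq0 ?pE0.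
(* The i-th binomial term divided by p^2 c. At i = p - 1 the term p (p c) is p^2 c itself; for
   smaller i the natural subtractions are exact. *)
pose k i := if i == p.-1 then 1 else 'C(p, i)%:R * p%:R ^+ (p - i - 2) * c ^+ (p - i - 1).
have kE i : (i < p)%N -> 'C(p, i)%:R * (p%:R * c) ^+ (p - i) = p%:R ^+ 2 * c * k i.
  move=> ip; rewrite /k; case: eqP => [-> | /eqP ni].
    have -> : (p - p.-1 = 1)%N by rewrite -[X in (X - _)%N](prednK p0) subSnn.
    have -> : 'C(p, p.-1) = p by rewrite -[in X in 'C(X, _)](prednK p0) binSn prednK.
    by rewrite mulr1 expr1 mulrA.
  have [n nE] : exists n, (p - i = n.+2)%N by exists (p - i - 2)%N; lia.
  by rewrite nE subn2 subn1 /= exprMn !exprS; ring.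
have xE : x ^+ p = \sum_(i < p) k i * x ^+ i.
  apply: (mulfI d0); rewrite mulr_sumr.
  have : (p%:R * c + x) ^+ p = alpha ^+ p * x ^+ p.
    by rewrite -xb -exprMn; congr (_ ^+ _); ring.
  rewrite alphaP bE -/c exprDn big_ord_recr /= subnn expr0 mul1r binn mulr1n mulrDl mul1r.
  rewrite addrC => /addrI <-; apply: eq_bigr => i _.
  by rewrite mulrA -kE // -mulr_natl mulrA.
apply: (@monic_root_algint _ _ ('X ^+ p - \poly_(i < p) k i)).
- rewrite monicE lead_coefDl ?lead_coefXn // size_polyN size_polyXn ltnS.
  exact: size_poly.
- rewrite /root !hornerE horner_poly xE subrr //.
move=> i; rewrite coefB coefXn coef_poly rpredB ?rpred_nat //.
case: ifP => _; rewrite ?rpred0 // /k; case: ifP => _; rewrite ?rpred1 //.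
by apply: rpredM; [apply: rpredM|]; rewrite ?rpredX ?rpred_nat.
Qed.

(** For y = [Lcomb m], the trace of y (alpha^(p-j) - 1) is p (a m_j - m_0). The p-th power of
    alpha^(p-j) - 1 is a^(p-j) - 1 = 0 modulo p, so the trace is nilpotent modulo p, hence divisible
    by p because p O_K is radical. *)
Lemma coef_congr m j : unramified_in p K -> (0 < j < p)%N -> Lcomb m \in OE ->
  val a * m j - m 0%N \in OK.
Proof.
move=> unr jp mO; set g := alpha ^+ (p - j) - 1.
have gO : g \in OE by rewrite rpredB ?rpred1 ?rpredX ?alpha_int.
have [w wO gE] : exists2 w, w \in OE & g ^+ p = p%:R * w.
  have [w wO wE] := @frobenius_mod _ OE p g 1 p_prime gO (rpred1 _).
  have aj : (alpha ^+ (p - j)) ^+ p = 1 + p%:R * (p%:R * (val b)%:A * \sum_(i < p - j) (val a)%:A ^+ i).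
    rewrite -exprM mulnC exprM alphaP.
    apply/eqP; rewrite addrC -subr_eq subrX1 bE; apply/eqP; ring.
  move: wE; rewrite /g subrK aj expr1n => wE.
  exists (p%:R * (val b)%:A * \sum_(i < p - j) (val a)%:A ^+ i - w).
    rewrite rpredB // rpredM ?rpredM ?rpred_nat ?algint_alg ?(valP b) //.
    by apply: rpred_sum => i _; rewrite rpredX // algint_alg (valP a).
  apply/eqP; rewrite mulrBr eq_sym subr_eq -(inj_eq (addrI 1)) wE; apply/eqP; ring.
have trO : p%:R * (val a * m j - m 0%N) \in OK.
  by rewrite mulrBr rpredB ?coef0_int // mulrA coef_dual_int.
have pO0 : (p%:R : 'O K) != 0.
  by rewrite -(inj_eq val_inj) rmorph_nat rmorph0 rat_fieldExt_natr_eq0 -lt0n.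
have [||||l [w' w'E]] := @Ltrace_nil p%:R (Lcomb m * g) p (Lcomb m ^+ p * w) pO0 _ _ _ (toO trO).
- by rewrite rpredM.
- by rewrite rpredM ?rpredX.
- rewrite exprMn gE mulrCA; congr (_ * _).
  by rewrite rmorph_nat -in_algE rmorph_nat.
- rewrite mulrBr mulr1 /Ltrace; under eq_bigr do rewrite rmorphB /=.
  rewrite sumrB -!/(Ltrace _) Ltrace_dual // Ltrace0 val_toO -scalerBl.
  by rewrite mulrBr mulrA.
have [|v vE] := @unramified_radical K p l (toO trO) p0 unr; first by exists w'.
have pK : p%:R != 0 :> K by rewrite rat_fieldExt_natr_eq0 -lt0n.
suff -> : val a * m j - m 0%N = val v by apply: valP.
apply: (mulfI pK); move/(congr1 val): vE; rewrite val_toO => ->.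
by rewrite rmorphM rmorph_nat.
Qed.

End Kummer.

(** * Reindexing modulo p *)

Section Periodic.
Variables (p d : nat).
Hypotheses (p0 : (0 < p)%N) (cop : coprime p d).

(** Multiplication by d permutes the residues modulo p. *)
Lemma sum_periodic (V : nmodType) (F : nat -> V) : (forall k, F (k %% p)%N = F k) ->
  \sum_(k < p) F (d * k)%N = \sum_(k < p) F k.
Proof.
move=> Fp; pose f (k : 'I_p) := Ordinal (ltn_pmod (d * k) p0).
rewrite [RHS](reindex_inj (h := f)) /=; first by apply: eq_bigr => k _; rewrite Fp.
suff inj (k l : 'I_p) : (k <= l)%N -> f k = f l -> k = l.
  move=> k l fkl; have [kl | /ltnW lk] := leqP k l; first exact: inj.
  by apply/esym/inj.
move=> kl /(congr1 val) /= /esym/eqP; rewrite eqn_mod_dvd ?leq_mul2l ?kl ?orbT //.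
rewrite -mulnBr Gauss_dvdr // => /dvdnP[q qE]; apply: val_inj => /=.
case: q qE => [|q]; rewrite ?mulSn => qE; have := ltn_ord l; lia.
Qed.

End Periodic.

(** The natural number p - 1 stands for -1 modulo p, here and in the exponents of zeta and sigma. *)
Lemma dvdn_pred_mulD p j k : (0 < p)%N -> (j < p)%N -> (k < p)%N ->
  (p %| p.-1 * j + k)%N = (j == k).
Proof.
case: p => // p _ jp kp /=; apply/idP/eqP => [pX | ->]; last first.
  by rewrite addnC -mulSn dvdn_mulr.
have E : (p * j + k + (j - k) = p.+1 * j + (k - j))%N by rewrite mulSn; lia.
have: (p.+1 %| j - k)%N = (p.+1 %| k - j)%N.
  by rewrite -(dvdn_addr (j - k) pX) E dvdn_addr // dvdn_mulr.
have [jk | /ltnW kj] := leqP j k.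
  rewrite (eqP jk) dvdn0 => /esym/dvdnP[q]; case: q => [|q]; rewrite ?mulSn; lia.
rewrite (eqP kj) dvdn0 => /dvdnP[q]; case: q => [|q]; rewrite ?mulSn; lia.
Qed.

(** * The Galois group, the eigenvalues of H and the associated order *)

Section HopfGalois.
Variables (K : fieldExtType rat) (E : splittingFieldType K).
Variables (p : nat) (alpha zeta : E) (a b : 'O K) (sigma tau : gal_of {:E}) (d : nat).
Variable eta : {perm galX tau}.
Hypotheses (p_prime : prime p) (zeta_prim : p.-primitive_root zeta).
Hypothesis p_unr : unramified_in p K.
Hypothesis genE : <<<<1; alpha>>; zeta>>%VS = {:E}%VS.
Hypothesis dimL : \dim <<1; alpha>> = p.
Hypotheses (alphaO : alpha \in algint <<1; alpha>>%AS) (alphaP : alpha ^+ p = (val a)%:A).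
Hypothesis aE : a = 1 + p%:R ^+ 2 * b.
Hypothesis d_prim : (p.-1).-primitive_root (d%:R : 'F_p).
Hypotheses (sigma_alpha : sigma alpha = zeta * alpha) (sigma_zeta : sigma zeta = zeta).
Hypotheses (tau_alpha : tau alpha = alpha) (tau_zeta : tau zeta = zeta ^+ d).
Hypothesis etaE : forall i : nat, eta (mkcoset <[tau]> (sigma ^+ i)%g) =
  mkcoset <[tau]> (sigma ^+ i * sigma^-1)%g.

Local Notation L := <<1; alpha>>%AS.
Local Notation OE := (algint {:E}%AS).
Local Notation OK := (algint (aspacef K)).
Local Notation mk := (mkcoset <[tau]>).
Local Notation Lc := (Lcomb p alpha).

Let p0 : (0 < p)%N := prime_gt0 p_prime.
Let alpha0 : alpha != 0 := alpha_neq0 p_prime dimL.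
Let zetap : zeta ^+ p = 1 := prim_expr_order zeta_prim.
Let sXa := sigmaX_alpha sigma_alpha sigma_zeta.
Let sXz := sigmaX_zeta sigma_zeta.

Lemma gal_alphaP (g : gal_of {:E}) : exists i, g alpha = zeta ^+ i * alpha.
Proof.
have /(prim_rootP zeta_prim)[i iE] : (g alpha / alpha) ^+ p = 1.
  by rewrite exprMn exprVn -rmorphXn alphaP /= gal_alg -alphaP mulfV // expf_neq0.
by exists i; rewrite -iE divfK.
Qed.

Lemma gal_zetaP (g : gal_of {:E}) : exists2 m, coprime p m & g zeta = zeta ^+ m.
Proof.
have /(prim_rootP zeta_prim)[m mE] : g zeta ^+ p = 1 by rewrite -rmorphXn zetap rmorph1.
exists m => //; rewrite prime_coprime // (prim_order_dvd zeta_prim) -mE.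
rewrite fmorph_eq1 -[zeta]expr1 -(prim_order_dvd zeta_prim) dvdn1.
by apply: contraL p_prime => /eqP ->.
Qed.

Lemma gal_eq (g h : gal_of {:E}) : g alpha = h alpha -> g zeta = h zeta -> g = h.
Proof.
move=> ga gz; have ghK x : g x = h x -> (g * h^-1)%g x = x.
  by move=> gx; rewrite galM ?memvf // gx -galM ?memvf // mulgV gal_id.
have sub : (<<<<1; alpha>>; zeta>> <= fixedField [set (g * h^-1)%g])%VS.
  have fixP x : g x = h x -> x \in fixedField [set (g * h^-1)%g].
    by move=> /ghK gx; apply/fixedFieldP; rewrite ?memvf // => _ /set1P ->.
  apply/FadjoinP; split; last exact: fixP.
  by apply/FadjoinP; split; [exact: sub1v | exact: fixP].
apply/eqP/gal_eqP => x _.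
have xgen : x \in <<<<1; alpha>>; zeta>>%VS by rewrite genE memvf.
have /mem_fixedFieldP[_ /(_ _ (set11 _)) xE] := subvP sub x xgen.
by rewrite -[in RHS]xE -galM ?memvf // mulgKV.
Qed.

Lemma tauX_alpha l : (tau ^+ l)%g alpha = alpha.
Proof. by elim: l => [|l IH]; rewrite ?expg0 ?gal_id // expgSr galM ?memvf // IH. Qed.

Lemma tauX_zeta l : (tau ^+ l)%g zeta = zeta ^+ (d ^ l).
Proof.
elim: l => [|l IH]; first by rewrite expg0 gal_id.
by rewrite expgSr galM ?memvf // IH rmorphXn /= tau_zeta -exprM expnS.
Qed.

(** As d generates the units modulo p, the powers of tau realize every conjugate of zeta. *)
Lemma primitive_residue m : coprime p m -> exists l, zeta ^+ m = zeta ^+ (d ^ l).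
Proof.
move=> pm; have m0 : (m%:R : 'F_p) != 0.
  rewrite -val_eqE /= val_Fp_nat //.
  by rewrite -[_ == _]/(p %| m)%N -prime_coprime.
have : (m%:R : 'F_p) ^+ p.-1 = 1.
  apply: (mulfI m0); rewrite mulr1 -exprS prednK //.
  by have := expf_card (m%:R : 'F_p); rewrite card_Fp.
move/(prim_rootP d_prim) => [l lE]; exists l.
rewrite -(prim_expr_mod zeta_prim m) -(prim_expr_mod zeta_prim (d ^ l)); congr (_ ^+ _).
by move/(congr1 val): lE; rewrite -natrX /= !val_Fp_nat.
Qed.

Lemma gal_fix_alpha (g : gal_of {:E}) : g alpha = alpha -> g \in <[tau]>%g.
Proof.
move=> ga; have [m pm gz] := gal_zetaP g; have [l lE] := primitive_residue pm.
have -> : g = (tau ^+ l)%g by apply: gal_eq; rewrite ?tauX_alpha ?tauX_zeta // gz.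
exact: mem_cycle.
Qed.

(** E / K is Galois, and every automorphism is some tau^l followed by some sigma^i. *)
Lemma gal_fixed_scalar x : sigma x = x -> tau x = x -> exists m : K, x = m%:A.
Proof.
move=> sx tx.
have powfix (g : gal_of {:E}) n : g x = x -> (g ^+ n)%g x = x.
  by move=> gx; elim: n => [|n IH]; rewrite ?expg0 ?gal_id // expgSr galM ?memvf // IH.
apply/vlineP; have gal1 : galois 1 {:E}.
  rewrite /galois sub1v normalFieldf andbT; apply/separableP => y _.
  apply: pcharf0_separable => n; rewrite !inE /= natrE_eq0.
  by case: n => // n; rewrite andbF.
rewrite -(galois_fixedField gal1); apply/fixedFieldP; rewrite ?memvf // => g _.
have [i gi] := gal_alphaP g; have [m pm gz] := gal_zetaP g.
have [l lE] := primitive_residue pm.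
have -> : g = (tau ^+ l * sigma ^+ i)%g.
  apply: gal_eq; rewrite galM ?memvf //; first by rewrite tauX_alpha sXa.
  by rewrite tauX_zeta rmorphXn /= sXz gz.
by rewrite galM ?memvf // !powfix.
Qed.

(** The group generated by tau is the stabilizer of alpha, so X is identified with the conjugates of
    alpha. *)
Lemma mk_eqP (g h : gal_of {:E}) : reflect (g alpha = h alpha) (mk g == mk h).
Proof.
rewrite -val_eqE /=; apply: (iffP eqP) => [/rcoset_eqP | gh].
  rewrite mem_rcoset => /cycleP[l lE].
  by rewrite -(mulgKV h g) lE galM ?memvf // tauX_alpha.
apply/rcoset_eqP; rewrite mem_rcoset; apply: gal_fix_alpha.
by rewrite galM ?memvf // gh -galM ?memvf // mulgV gal_id.
Qed.

Lemma mk_sigmaP (C : galX tau) : exists i, C = mk (sigma ^+ i)%g.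
Proof.
have /rcosetsP[g _ gE] := valP C; have [i gi] := gal_alphaP g; exists i.
have -> : C = mk g by apply: val_inj; rewrite gE.
by apply/eqP/mk_eqP; rewrite gi sXa.
Qed.

Lemma sigmaXp : (sigma ^+ p = 1)%g.
Proof. by apply: gal_eq; rewrite ?sXa ?sXz gal_id // zetap mul1r. Qed.

Lemma etaX_mk k i : (eta ^+ k)%g (mk (sigma ^+ i)%g) = mk (sigma ^+ (i + k * p.-1))%g.
Proof.
have sV : (sigma^-1 = sigma ^+ p.-1)%g.
  by apply/eqP; rewrite eq_invg_mul -expgS prednK // sigmaXp.
elim: k => [|k IH]; first by rewrite expg0 perm1 mul0n addn0.
by rewrite expgSr permM IH etaE sV -expgD -addnA mulSnr.
Qed.

Lemma order_eta : #[eta]%g = p.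
Proof.
apply: nt_prime_order => //.
  apply/permP => C; have [i ->] := mk_sigmaP C; rewrite etaX_mk perm1.
  by apply/eqP/mk_eqP; rewrite !sXa exprD exprM zetap expr1n mulr1.
apply/eqP => eta1; have := etaX_mk 1 0; rewrite eta1 expg1n perm1.
move=> /eqP/mk_eqP; rewrite !sXa add0n mul1n => /(mulIf alpha0)/eqP.
rewrite (eq_prim_root_expr zeta_prim) mod0n modn_small ?prednK //.
by apply/negP; rewrite eq_sym -lt0n -ltnS prednK // prime_gt1.
Qed.

Lemma eta_mod k : (eta ^+ (k %% p) = eta ^+ k)%g.
Proof. by rewrite -{1}order_eta expg_mod_order. Qed.

(** On the conjugates of alpha, eta is multiplication by zeta^-1, which conjugation by g turns into
    multiplication by g(zeta)^-1 = zeta^-m. *)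
Lemma etaJ (g : gal_of {:E}) m k : g zeta = zeta ^+ m ->
  ((eta ^+ k) ^ ltrans <[tau]> g = eta ^+ (m * k))%g.
Proof.
move=> gz; apply/permP => D; rewrite -[D](permKV (ltrans <[tau]> g)).
set C := ((ltrans <[tau]> g)^-1)%g D; have [i ->] := mk_sigmaP C.
have [j gj] := gal_alphaP g.
have mkg n : ltrans <[tau]> g (mk (sigma ^+ n)%g) = mk (sigma ^+ (m * n + j))%g.
  rewrite ltransE; apply/eqP/mk_eqP; rewrite galM ?memvf // !sXa rmorphM rmorphXn /=.
  by rewrite gz gj -exprM mulrA -exprD.
by rewrite permJ etaX_mk !mkg etaX_mk mulnDr addnAC mulnA.
Qed.

Lemma etaJ_mem (g : gal_of {:E}) n :
  (n ^ ltrans <[tau]> g \in <[eta]>)%g = (n \in <[eta]>)%g.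
Proof.
apply: memJ_norm; rewrite inE -cycleJ; have [m _ gz] := gal_zetaP g.
by rewrite -[eta]expg1 (etaJ _ gz) mulnC expgM expg1 cycle_subG mem_cycle.
Qed.

(* omega = zeta^-1, with a natural exponent *)
Local Notation omega := (zeta ^+ p.-1).

Lemma zeta_orthogonal j k : (j < p)%N -> (k < p)%N ->
  \sum_(l < p) omega ^+ (j * l) * zeta ^+ (k * l) = if j == k then p%:R else 0.
Proof.
move=> jp kp; rewrite -(dvdn_pred_mulD p0 jp kp) -(prim_root_sum _ zeta_prim).
by apply: eq_bigr => l _; rewrite -exprM -exprD mulnDl mulnA.
Qed.

Section Eigenvalues.
Variable h : {ffun {perm galX tau} -> E}.
Hypothesis hH : hopf_alg eta h.
Local Notation c := (fun k => h (eta ^+ k)%g).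

(** Compare the coefficients at eta^(mk) in g . h = h, using [etaJ]. *)
Lemma hopf_coef_gal (g : gal_of {:E}) m k : g zeta = zeta ^+ m -> g (c k) = c (m * k)%N.
Proof.
move=> gz; rewrite /= -(etaJ k gz) -[h in RHS](hH.2 g) ?gal_actE //.
by rewrite gal_kHom ?sub1v // k1AHom.
Qed.

(** This is the eigenvalue of h on alpha^j. It is fixed by sigma, which fixes zeta and all c_k, and
    by tau, which permutes the summands through k -> d k. *)
Lemma hopf_eigenvalue j : exists m : K, \sum_(k < p) c k * zeta ^+ (j * k) = m%:A.
Proof.
apply: gal_fixed_scalar; rewrite rmorph_sum /=.
  apply: eq_bigr => k _; rewrite rmorphM rmorphXn /= sigma_zeta.
  by rewrite (@hopf_coef_gal sigma 1) ?expr1 // mul1n.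
have pd : coprime p d.
  rewrite prime_coprime // (prim_order_dvd zeta_prim) -tau_zeta fmorph_eq1.
  rewrite -[zeta]expr1 -(prim_order_dvd zeta_prim) dvdn1.
  by apply: contraL p_prime => /eqP ->.
rewrite -[RHS](sum_periodic p0 pd (F := fun k => c k * zeta ^+ (j * k))); last first.
  move=> k; rewrite eta_mod; congr (_ * _).
  by rewrite -(prim_expr_mod zeta_prim) modnMmr (prim_expr_mod zeta_prim).
apply: eq_bigr => k _; rewrite rmorphM rmorphXn /= tau_zeta (hopf_coef_gal _ tau_zeta).
by rewrite -exprM mulnCA.
Qed.

Variable lam : nat -> K.
Hypothesis lamE : forall j, \sum_(k < p) c k * zeta ^+ (j * k) = (lam j)%:A.

Lemma hopf_act_Lcomb m : hopf_act sigma eta h (Lc m) = Lc (fun j => lam j * m j).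
Proof.
rewrite /hopf_act order_eta.
under eq_bigr do rewrite (sigmaX_Lcomb _ sigma_alpha sigma_zeta) mulr_sumr.
rewrite exchange_big; apply: eq_bigr => j _ /=.
under eq_bigr do rewrite -scalerAr mulrA.
rewrite -scaler_sumr -mulr_suml lamE mulr_algl scalerA mulrC //.
Qed.

(** Fourier inversion on Z / p. *)
Lemma hopf_coefE k : (k < p)%N -> p%:R * c k = \sum_(j < p) lam j *: omega ^+ (j * k).
Proof.
move=> kp; under eq_bigr do rewrite -mulr_algl -lamE mulr_suml.
rewrite exchange_big /= (bigD1 (Ordinal kp)) //= [X in _ + X]big1 ?addr0 => [|l lk].
  under eq_bigr do rewrite -mulrA mulrC [_ * omega ^+ _]mulrC [(_ * k)%N]mulnC.
  by rewrite -mulr_suml zeta_orthogonal // eqxx.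
under eq_bigr do rewrite -mulrA mulrC [_ * omega ^+ _]mulrC [(_ * k)%N]mulnC [(_ * l)%N]mulnC.
by rewrite -mulr_suml zeta_orthogonal // -val_eqE eq_sym /= in lk *; rewrite (negPf lk) mul0r.
Qed.

Lemma Lcomb_delta j c : (j < p)%N -> Lc (fun i => if i == j then c else 0) = c *: alpha ^+ j.
Proof.
move=> jp; rewrite /Lcomb (bigD1 (Ordinal jp)) //= eqxx big1 ?addr0 // => i.
by rewrite -val_eqE /= => /negPf ->; rewrite scale0r.
Qed.

Lemma hopf_act_pow j c : (j < p)%N ->
  hopf_act sigma eta h (c *: alpha ^+ j) = (lam j * c) *: alpha ^+ j.
Proof.
move=> jp; rewrite -!Lcomb_delta // hopf_act_Lcomb /Lcomb; apply: eq_bigr => i _.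
by case: eqP => [-> | _]; rewrite ?mulr0.
Qed.

(** Subtracting lam_0 from all eigenvalues changes only c_0, by lam_0. So c_k is the sum of the
    ((lam_j - lam_0) / p) omega^(jk), plus lam_0 when k = 0. *)
Lemma hopf_coef_int : (forall j, (j < p)%N -> lam j \in OK) ->
  (forall j, (j < p)%N -> (lam j - lam 0%N) / p%:R \in OK) -> forall n, h n \in OE.
Proof.
move=> lamO lam_congr n.
case: (boolP (n \in <[eta]>%g)) => [/cyclePmin[k] | /(hH.1 n) ->]; last exact: rpred0.
rewrite order_eta => kp ->.
have pK : p%:R != 0 :> K by rewrite rat_fieldExt_natr_eq0 -lt0n.
have pE : p%:R != 0 :> E by rewrite natrE_eq0 -lt0n.
have zO : zeta \in OE by apply: (algint_root1 p0 zetap).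
have -> : h (eta ^+ k)%g = \sum_(j < p) ((lam j - lam 0%N) / p%:R) *: omega ^+ (j * k) +
    (if 0%N == k then (lam 0%N)%:A else 0).
  apply: (mulfI pE); rewrite hopf_coefE // mulrDr mulr_sumr.
  have -> : p%:R * (if 0%N == k then (lam 0%N)%:A else 0) =
      \sum_(j < p) lam 0%N *: omega ^+ (j * k) :> E.
    have E1 : \sum_(j < p) omega ^+ (j * k) = if 0%N == k then p%:R else 0.
      rewrite eq_sym -(zeta_orthogonal kp p0); apply: eq_bigr => j _.
      by rewrite mul0n expr0 mulr1 mulnC.
    by rewrite -scaler_sumr E1; case: eqP; rewrite ?mulr0 ?scaler0 // mulr_algr.
  rewrite -big_split; apply: eq_bigr => j _ /=.
  have pA : p%:R = (p%:R : K)%:A :> E by rewrite -in_algE rmorph_nat.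
  by rewrite pA mulr_algl scalerA mulrC divfK // -scalerDl subrK.
rewrite rpredD //; last by case: ifP; rewrite ?rpred0 // algint_alg lamO.
apply: rpred_sum => j _; rewrite -mulr_algl rpredM ?algint_alg ?lam_congr //.
by rewrite !rpredX.
Qed.

(** Iterating h on alpha^j gives integers lam_j^n alpha^j; multiplying by alpha^(p-j) shows that a
    lam_j^n is integral for every n, so lam_j is almost integral. For the congruence, h sends (1/p)
    sum_j alpha^j to an integer with coordinates lam_j / p, to which [coef_congr] applies. *)
Lemma hopf_eigenvalue_int : {in algint L, forall x, hopf_act sigma eta h x \in algint L} ->
  (forall j, (j < p)%N -> lam j \in OK) /\
  (forall j, (j < p)%N -> (lam j - lam 0%N) / p%:R \in OK).
Proof.
move=> hO.
have pK : p%:R != 0 :> K by rewrite rat_fieldExt_natr_eq0 -lt0n.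
have aK : val a != 0 := a_neq0 p_prime dimL alphaP.
have aO : alpha \in OE := alpha_int alphaO.
have lamO j : (j < p)%N -> lam j \in OK.
  move=> jp; have [N N0 NO] := clear_denominator (val a)^-1.
  apply: (almost_integral N0) => n.
  have : lam j ^+ n *: alpha ^+ j \in algint L.
    elim: n => [|n IH]; first by rewrite scale1r rpredX.
    by rewrite exprS -hopf_act_pow // hO.
  rewrite algintE => /andP[_ lO].
  have : (lam j ^+ n * val a)%:A \in OE.
    rewrite -scalerA -alphaP -(subnKC (ltnW jp)) exprD scalerAl.
    by rewrite rpredM ?rpredX.
  rewrite algint_alg => laO.
  rewrite (_ : N%:R * _ = N%:R * (val a)^-1 * (lam j ^+ n * val a)); first exact: rpredM.
  by rewrite [lam j ^+ n * _]mulrC mulrA mulfVK.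
split=> // j jp.
have x0O := geometric_int p_prime zeta_prim dimL alphaO alphaP aE.
have x0E : p%:R^-1 * \sum_(j < p) alpha ^+ j = Lc (fun=> p%:R^-1).
  rewrite mulr_sumr; apply: eq_bigr => i _.
  by rewrite -mulr_algl -in_algE fmorphV rmorph_nat.
have := hO _ x0O; rewrite x0E hopf_act_Lcomb algintE => /andP[_ hxO].
case: (posnP j) => [-> | j0]; first by rewrite subrr mul0r rpred0.
have jlt : (0 < j < p)%N by rewrite j0.
have cO := coef_congr p_prime zeta_prim dimL alphaO alphaP sigma_alpha sigma_zeta aE p_unr jlt hxO.
rewrite (_ : (lam j - lam 0%N) / p%:R =
  val a * (lam j / p%:R) - lam 0%N / p%:R - p%:R * val b * lam j).
  by rewrite rpredB // !rpredM ?rpred_nat ?(valP b) ?lamO.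
have -> : val a = 1 + p%:R ^+ 2 * val b.
  by rewrite aE rmorphD rmorphM rmorphXn rmorph_nat rmorph1.
by field.
Qed.

End Eigenvalues.

Lemma hopf_eigenvalues h : hopf_alg eta h -> exists lam : nat -> K,
  forall j, \sum_(k < p) h (eta ^+ k)%g * zeta ^+ (j * k) = (lam j)%:A.
Proof.
move=> hH; have /choice[lam lamE] : forall j, exists m : K,
    \sum_(k < p) h (eta ^+ k)%g * zeta ^+ (j * k) = m%:A by exact: hopf_eigenvalue.
by exists lam.
Qed.

Lemma assoc_order_eq : assoc_order alpha sigma eta =i int_hopf_order eta.
Proof.
move=> h; apply/asboolP/asboolP => -[hH hO]; have [lam lamE] := hopf_eigenvalues hH.
  split=> //; have [] := hopf_eigenvalue_int lamE hO.
  exact: hopf_coef_int.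
split=> // x xL; have [m mE] : exists m, x = Lc m.
  by apply: LcombP => //; move: xL; rewrite algintE => /andP[].
rewrite algintE mE (hopf_act_Lcomb lamE) Lcomb_mem -(hopf_act_Lcomb lamE) -mE.
rewrite /hopf_act; apply: rpred_sum => k _; apply: rpredM; first exact: hO.
by apply: algint_gal; move: xL; rewrite algintE => /andP[].
Qed.

(** The coefficients are dictated by Fourier inversion. They are G-invariant because g with g(zeta)
    = zeta^m multiplies by m both the exponent of eta and that of omega. *)
Lemma hopf_of_eigenvalues lam : exists2 h, hopf_alg eta h &
  forall j, (j < p)%N -> \sum_(k < p) h (eta ^+ k)%g * zeta ^+ (j * k) = (lam j)%:A.
Proof.
have pE : p%:R != 0 :> E by rewrite natrE_eq0 -lt0n.
pose c k := p%:R^-1 * \sum_(j < p) lam j *: omega ^+ (j * k).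
have omegap : omega ^+ p = 1 by rewrite exprAC zetap expr1n.
have cp k : c (k %% p)%N = c k.
  congr (_ * _); apply: eq_bigr => j _; congr (_ *: _).
  rewrite ![(j * _)%N]mulnC !exprM; congr (_ ^+ _).
  by rewrite [in RHS](divn_eq k p) exprD mulnC exprM omegap expr1n mul1r.
(* The sum has exactly one term when n is a power of eta, and none otherwise. *)
pose h := [ffun n => \sum_(k < p | n == (eta ^+ k)%g) c k].
have hE k : h (eta ^+ k)%g = c k.
  rewrite ffunE (big_pred1 (Ordinal (ltn_pmod k p0))) /= ?cp // => i.
  by rewrite eq_expg_mod_order order_eta [(i %% p)%N]modn_small // eq_sym.
have hN n : n \notin <[eta]>%g -> h n = 0.
  move=> nN; rewrite ffunE big_pred0 // => k; apply/negP => /eqP nE.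
  by case/negP: nN; rewrite nE mem_cycle.
exists h; first split=> [| g _].
- exact: hN.
- have [m _ gz] := gal_zetaP g.
  apply/ffunP => n; rewrite -[n](conjgKV (ltrans <[tau]> g)) gal_actE.
  set n' := (n ^ _)%g; case: (boolP (n' \in <[eta]>%g)) => [/cycleP[k ->] | n'N].
    rewrite (etaJ _ gz) !hE rmorphM rmorph_sum fmorphV rmorph_nat /=; congr (_ * _).
    apply: eq_bigr => j _; rewrite linearZ /= !rmorphXn /= gz; congr (_ *: _).
    by rewrite -!exprM; congr (_ ^+ _); rewrite mulnCA [(m * (j * k))%N]mulnCA.
  by rewrite (hN _ n'N) hN ?rmorph0 // etaJ_mem.
move=> j jp; under eq_bigr do rewrite hE -mulrA mulr_suml.
rewrite -mulr_sumr exchange_big /= (bigD1 (Ordinal jp)) //= [X in _ + X]big1 ?addr0 => [|i ij].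
  under eq_bigr do rewrite -scalerAl.
  by rewrite -scaler_sumr zeta_orthogonal // eqxx -scalerAr mulVf.
under eq_bigr do rewrite -scalerAl.
by rewrite -scaler_sumr zeta_orthogonal // -val_eqE /= in ij *; rewrite (negPf ij) scaler0.
Qed.

(* The eigenvalues of H on the powers of alpha identify the associated order
   with the sequences of p integers that are congruent modulo p. *)
Lemma assoc_eigenvalues (h : assocO alpha sigma eta) : exists lam : nat -> 'O K,
  (forall j, (j < p)%N -> exists w, lam j = lam 0%N + p%:R * w) /\
  forall m, hopf_act sigma eta (val h) (Lc m) = Lc (fun j => val (lam j) * m j).
Proof.
have /asboolP[hH hO] := valP h; have [lam lamE] := hopf_eigenvalues hH.
have [lamO lam_congr] := hopf_eigenvalue_int lamE hO.
have pK : p%:R != 0 :> K by rewrite rat_fieldExt_natr_eq0 -lt0n.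
pose l j := if insub (lam j) is Some x then x : 'O K else 0.
have lE j : (j < p)%N -> val (l j) = lam j by move=> jp; rewrite /l insubT ?lamO.
exists l; split=> [j jp | m].
  exists (toO (lam_congr j jp)); apply: val_inj.
  rewrite rmorphD rmorphM rmorph_nat [X in _ = _ + _ * X]val_toO.
  by rewrite [LHS]lE // [X in _ = X + _]lE // mulrC divfK // addrC subrK.
by rewrite (hopf_act_Lcomb lamE); apply: eq_bigr => j _; rewrite lE.
Qed.

(** Membership in the associated order is checked on coefficients, through [assoc_order_eq]. *)
Lemma assoc_of_eigenvalues (lam : nat -> 'O K) :
  (forall j, (j < p)%N -> exists w, lam j = lam 0%N + p%:R * w) ->
  exists h : assocO alpha sigma eta, forall m,
    hopf_act sigma eta (val h) (Lc m) = Lc (fun j => val (lam j) * m j).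
Proof.
move=> lam_congr; have [h hH hE] := hopf_of_eigenvalues (fun j => val (lam j)).
have [mu muE] := hopf_eigenvalues hH.
have lE j : (j < p)%N -> val (lam j) = mu j.
  by move=> jp; have := hE j jp; rewrite muE => /(fmorph_inj (in_alg E)).
have pK : p%:R != 0 :> K by rewrite rat_fieldExt_natr_eq0 -lt0n.
have hA : h \in assoc_order alpha sigma eta.
  rewrite assoc_order_eq; apply/asboolP; split=> //; apply: (hopf_coef_int hH muE) => j jp.
    by rewrite -lE // (valP (lam j)).
  rewrite -!lE //; have [w ->] := lam_congr j jp.
  by rewrite rmorphD rmorphM rmorph_nat addrC addKr mulrC mulKf // (valP w).
exists (Sub h hA) => m; rewrite SubK (hopf_act_Lcomb muE).
by apply: eq_bigr => j _; rewrite lE.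
Qed.

(** The eigenvalues determine the coefficients, by [hopf_coefE]. *)
Lemma assoc_act_inj (h h' : assocO alpha sigma eta) :
  (forall j, (j < p)%N -> hopf_act sigma eta (val h) (alpha ^+ j) =
     hopf_act sigma eta (val h') (alpha ^+ j)) -> h = h'.
Proof.
move=> hh'; apply: val_inj; apply/ffunP => n.
have /asboolP[hH _] := valP h; have /asboolP[hH' _] := valP h'.
case: (boolP (n \in <[eta]>%g)) => [/cyclePmin[k] | nN]; last by rewrite hH.1 // hH'.1.
rewrite order_eta => kp ->.
have [lam lamE] := hopf_eigenvalues hH; have [lam' lamE'] := hopf_eigenvalues hH'.
have pE : p%:R != 0 :> E by rewrite natrE_eq0 -lt0n.
apply: (mulfI pE); rewrite (hopf_coefE lamE) // (hopf_coefE lamE') //.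
apply: eq_bigr => j _; congr (_ *: _).
have := hh' j (ltn_ord j); rewrite -[alpha ^+ j]scale1r.
rewrite (hopf_act_pow lamE) // (hopf_act_pow lamE') // !mulr1.
rewrite -[LHS]mulr_algl -[RHS]mulr_algl => /(mulIf (expf_neq0 _ alpha0)).
exact: (fmorph_inj (in_alg E)).
Qed.

End HopfGalois.

(** * Additive maps on tensor products and the local action *)

Lemma additive_sum (U V : zmodType) (F : U -> V) : (forall x y, F (x + y) = F x + F y) ->
  forall I (r : seq I) (Q : pred I) (G : I -> U),
    F (\sum_(i <- r | Q i) G i) = \sum_(i <- r | Q i) F (G i).
Proof.
move=> FD I r Q G; apply: (big_morph F FD).
by apply: (addrI (F 0)); rewrite -FD !addr0.
Qed.

Section TensorMap.
Variables (R S : comNzRingType) (f : R -> S).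

Lemma tens_sumr (M : lmodType R) s I (r : seq I) (Q : pred I) (G : I -> M) :
  tens f s (\sum_(i <- r | Q i) G i) = \sum_(i <- r | Q i) tens f s (G i).
Proof. by apply: (additive_sum (F := tens f s)) => x y; apply: tensDr. Qed.

Lemma tens0l (M : lmodType R) (m : M) : tens f 0 m = 0.
Proof. by apply: (addrI (tens f 0 m)); rewrite -tensDl !addr0. Qed.

Lemma tens0r (M : lmodType R) s : tens f s (0 : M) = 0.
Proof. by apply: (addrI (tens f s 0)); rewrite -tensDr !addr0. Qed.

Section Induction.
Variables (M : lmodType R) (V : zmodType) (F G : tensor f M -> V).
Hypotheses (FD : forall x y, F (x + y) = F x + F y) (GD : forall x y, G (x + y) = G x + G y).

Lemma eq_tensor : (forall s m, F (tens f s m) = G (tens f s m)) -> F =1 G.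
Proof.
move=> FG; apply: tensor_ind => [|x y IHx IHy|//]; last by rewrite FD GD IHx IHy.
have F0 : F 0 = 0 by apply: (addrI (F 0)); rewrite -FD !addr0.
have G0 : G 0 = 0 by apply: (addrI (G 0)); rewrite -GD !addr0.
by rewrite F0 G0.
Qed.

End Induction.

Section Map.
Variables (M N : lmodType R) (g : M -> N).
Hypotheses (gD : forall x y, g (x + y) = g x + g y) (gZ : forall r x, g (r *: x) = r *: g x).

Definition tensor_map := tensor_lift (f := f) (fun s m => tens f s (g m)).

Lemma tensor_mapE s m : tensor_map (tens f s m) = tens f s (g m).
Proof.
apply: tensor_liftE => [s1 s2 x|s1 x y|s1 r x]; first exact: tensDl.
  by rewrite gD tensDr.
by rewrite gZ tens_balanced.
Qed.

Lemma tensor_mapD x y : tensor_map (x + y) = tensor_map x + tensor_map y.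
Proof.
apply: tensor_liftD => [s1 s2 z|s1 z z'|s1 r z]; first exact: tensDl.
  by rewrite gD tensDr.
by rewrite gZ tens_balanced.
Qed.

End Map.
End TensorMap.

Section LocalAction.
Variables (K : fieldExtType rat) (E : splittingFieldType K).
Variables (alpha : E) (sigma tau : gal_of {:E}) (eta : {perm galX tau}).
Variables (P : {pred 'O K}) (C : completion P).
Local Notation L := <<1; alpha>>%AS.
Local Notation A := (assocO alpha sigma eta).

Lemma assoc_actDr (h : A) (x y : intring L) :
  assoc_act h (x + y) = assoc_act h x + assoc_act h y.
Proof. by apply: val_inj; rewrite /= hopf_act_add. Qed.

Lemma assoc_actZr (h : A) (r : 'O K) (x : intring L) :
  assoc_act h (r *: x) = r *: assoc_act h x.
Proof. by apply: val_inj; rewrite /= hopf_act_scale. Qed.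

Lemma assoc_actDl (h h' : A) (x : intring L) :
  assoc_act (h + h') x = assoc_act h x + assoc_act h' x.
Proof. by apply: val_inj; rewrite -[h]scale1r /= hopf_act_linear scale1r scale1r. Qed.

Lemma assoc_actZl (r : 'O K) (h : A) (x : intring L) :
  assoc_act (r *: h) x = r *: assoc_act h x.
Proof.
apply: val_inj; rewrite /= -[X in hopf_act _ _ X]addr0 hopf_act_linear.
rewrite [X in _ + X](_ : _ = 0) ?addr0 // /hopf_act big1 // => k _.
by rewrite ffunE mul0r.
Qed.

Let inner (b : A) := tensor_map (f := cemb_int C) (assoc_act b).

Let innerE b t y : inner b (tens _ t y) = tens _ t (assoc_act b y).
Proof. by apply: tensor_mapE; [exact: assoc_actDr | exact: assoc_actZr]. Qed.

Let innerD b x y : inner b (x + y) = inner b x + inner b y.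
Proof. by apply: tensor_mapD; [exact: assoc_actDr | exact: assoc_actZr]. Qed.

(** Unlike [local_actE], this allows an arbitrary tensor x, as additivity in x requires. *)
Lemma local_act_tens s b (x : at_prime C (intring L)) :
  local_act (tens (cemb_int C) s (b : A)) x = s *: inner b x.
Proof.
rewrite /local_act tensor_liftE // => [s1 s2 b'|s1 b1 b2|s1 r b'].
- by rewrite scalerDl.
- rewrite -scalerDr; congr (_ *: _); rewrite -!/(inner _ _).
  apply: (eq_tensor (F := inner (b1 + b2)) (G := fun x => inner b1 x + inner b2 x)).
  + exact: innerD.
  + by move=> y z; rewrite !innerD addrACA.
  + by move=> t y; rewrite !innerE assoc_actDl tensDr.
- rewrite -scalerA; congr (_ *: _); rewrite -!/(inner _ _).
  apply/esym; apply: (eq_tensor (F := inner (r *: b')) (G := fun x => cemb_int C r *: inner b' x)).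
  + exact: innerD.
  + by move=> y z; rewrite !innerD scalerDr.
  + by move=> t y; rewrite !innerE assoc_actZl tensZ mulrC tens_balanced.
Qed.

Lemma local_actDr h (x y : at_prime C (intring L)) :
  local_act h (x + y) = local_act h x + local_act (h : at_prime C A) y.
Proof.
apply: (eq_tensor (F := fun h => local_act h (x + y)) (G := fun h => local_act h x + local_act h y)).
- by move=> h1 h2; apply: local_actDl.
- by move=> h1 h2; rewrite !local_actDl addrACA.
- by move=> s b; rewrite !local_act_tens innerD scalerDr.
Qed.

Lemma to_local_fieldD (x y : at_prime C (intring L)) :
  to_local_field (x + y) = to_local_field x + to_local_field y.
Proof.
apply: tensor_liftD => [s1 s2 m|s1 m m'|s1 r m]; first exact: tensDl.
- by rewrite /= linearD tensDr.
- by rewrite /= linearZ tens_balanced.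
Qed.

Lemma local_act_sumr h I (r : seq I) (Q : pred I) (G : I -> at_prime C (intring L)) :
  local_act h (\sum_(k <- r | Q k) G k) =
  \sum_(k <- r | Q k) local_act (h : at_prime C A) (G k).
Proof. exact: (additive_sum (local_actDr h)). Qed.

Lemma local_act_suml (x : at_prime C (intring L)) I (r : seq I) (Q : pred I)
    (G : I -> at_prime C A) :
  local_act (\sum_(k <- r | Q k) G k) x = \sum_(k <- r | Q k) local_act (G k) x.
Proof. exact: (additive_sum (fun h h' => local_actDl h h' x)). Qed.

Lemma to_local_field_sum I (r : seq I) (Q : pred I) (G : I -> at_prime C (intring L)) :
  to_local_field (\sum_(k <- r | Q k) G k) = \sum_(k <- r | Q k) to_local_field (G k).
Proof. exact: (additive_sum to_local_fieldD). Qed.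

(* It suffices to invert h |-> h . x on pure tensors. *)
Lemma free_generatorI (x : at_prime C (intring L)) (g : at_prime C (intring L) -> at_prime C A) :
  (forall y z, g (y + z) = g y + g z) ->
  (forall s h, g (local_act (tens _ s h) x) = tens _ s h) ->
  (forall s y, local_act (g (tens _ s y)) x = tens _ s y) ->
  free_generator sigma eta x.
Proof.
move=> gD gl lg; exists g.
  apply: (@eq_tensor _ _ _ _ _ (fun h => g (local_act h x)) id) => [h h'|h h'|]; [|by []|exact: gl].
  exact: (etrans (congr1 g (local_actDl h h' x)) (gD _ _)).
apply: (@eq_tensor _ _ _ _ _ (fun y => local_act (g y) x) id) => [y z|y z|]; [|by []|exact: lg].
exact: (etrans (congr1 (fun h => local_act h x) (gD y z)) (local_actDl _ _ x)).
Qed.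

End LocalAction.

(** * The valuation of a completion and the local inverse t of P *)

Section Valuation.
Variables (K : fieldExtType rat) (P : prime_idealr ('O K)) (C : completion P).
Local Notation OK := (algint (aspacef K)).
Local Notation v := (@cval _ _ C).
Local Notation i := (cemb C).

Lemma cval1 : v 1 = 0.
Proof.
have := @cvalM _ _ C 1 1 (oner_neq0 _) (oner_neq0 _).
by rewrite mulr1 => /eqP; rewrite -subr_eq subrr eq_sym => /eqP.
Qed.

Lemma cvalV x : x != 0 -> v x^-1 = - v x.
Proof.
move=> x0; have := cvalM x0 (invr_neq0 x0); rewrite mulfV // cval1 => /esym/eqP.
by rewrite addrC addr_eq0 => /eqP.
Qed.

Lemma cvalX x n : x != 0 -> v (x ^+ n) = v x * n%:Z.
Proof.
move=> x0; elim: n => [|n IH]; first by rewrite expr0 cval1 mulr0.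
by rewrite exprS cvalM ?expf_neq0 // IH intS mulrDr mulr1.
Qed.

Lemma ideal_pow1P (x : 'O K) : ideal_pow P 1 x <-> x \in P.
Proof.
split=> [[s [sP ->]] | ]; last exact: ideal_pow1.
rewrite big_seq rpred_sum // => u us; rewrite mulrC primeMl //.
by have [] := sP _ us.
Qed.

Lemma cval_int (x : 'O K) : x != 0 -> 0 <= v (i (val x)).
Proof.
move=> x0; have /(@cval_adic _ _ C x 0) : ideal_pow P 0 x by [].
by rewrite /vge fmorph_eq0 (negPf (x0 : val x != 0)).
Qed.

Lemma cval_prime (x : 'O K) : x != 0 -> (x \in P) = (1 <= v (i (val x))).
Proof.
move=> x0; have vE : vge v 1%N%:Z (i (val x)) = (1 <= v (i (val x))).
  by rewrite /vge fmorph_eq0 (negPf (x0 : val x != 0)).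
rewrite -vE; apply/idP/idP => [xP | /(@cval_adic _ _ C x 1)/ideal_pow1P //].
by apply/(@cval_adic _ _ C x 1)/ideal_pow1P.
Qed.

Lemma cval_unit (x : 'O K) : x \notin P -> v (i (val x)) = 0.
Proof.
move=> xP; have x0 : x != 0 by apply: contraNneq xP => ->; rewrite rpred0.
have := cval_int x0; move: xP; rewrite cval_prime //.
by case: (v _) => [[|n]|n].
Qed.

Section Inverse.
Variable t : K.
Hypothesis tP : forall x : 'O K, x \in P -> t * val x \in OK.

Lemma inverse_ideal_pow n (x : 'O K) : ideal_pow P n x -> t ^+ n * val x \in OK.
Proof.
elim: n x => [|n IH] x; first by rewrite mul1r (valP x).
move=> [s [sP ->]]; rewrite rmorph_sum mulr_sumr big_seq; apply: rpred_sum => u us.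
have [u1 u2] := sP _ us; rewrite rmorphM exprS mulrACA.
by rewrite rpredM ?tP // IH.
Qed.

Hypothesis tv : exists w u : 'O K, [/\ w \in P, u \notin P & t * val w = val u].

Lemma inverse_neq0 : t != 0.
Proof.
have [w [u [_ uP tE]]] := tv; apply/eqP => t0; case/negP: uP.
by rewrite (_ : u = 0) ?rpred0 //; apply: val_inj; rewrite -tE t0 mul0r rmorph0.
Qed.

(** Otherwise P is contained in P^2, and multiplying w, now in P^2, by t puts u = t w in P. *)
Lemma prime_not_square : exists x : 'O K, [/\ x \in P, x != 0 & v (i (val x)) = 1].
Proof.
apply: contrapT => H; have [w [u [wP uP tE]]] := tv.
have P2 x : x \in P -> ideal_pow P 2 x.
  move=> xP; apply/(@cval_adic _ _ C x 2); rewrite /vge fmorph_eq0.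
  have [// | x0 /=] := eqVneq (val x) 0.
  have := xP; rewrite cval_prime //; rewrite le_eqVlt => /orP[/eqP vx|]; last first.
    by rewrite (_ : 2%N%:Z = 1 + 1) // lezD1.
  by case: H; exists x.
have [s [sP wE]] := P2 _ wP; case/negP: uP.
have tO j : j \in s -> t * val j.1 \in OK by move=> /sP[/tP].
have -> : u = \sum_(j <- s) (if insub (t * val j.1) is Some z then z : 'O K else 0) * j.2.
  apply: val_inj; rewrite -tE wE !rmorph_sum mulr_sumr big_seq [RHS]big_seq.
  apply: eq_bigr => j js; rewrite !rmorphM mulrA; congr (_ * _).
  by rewrite insubT ?tO // => jO; rewrite SubK.
rewrite big_seq rpred_sum // => j js; apply: primeMl.
by apply/ideal_pow1P; have [] := sP _ js.
Qed.

(** Since t w = u is a unit at P while w is in P, v(t) <= -1; since t x is integral for an x of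
    valuation 1, v(t) >= -1. *)
Lemma cval_inverse : v (i t) = -1.
Proof.
have [x [xP x0 vx]] := prime_not_square; have [w [u [wP uP tE]]] := tv.
have t0 := inverse_neq0.
have w0 : w != 0.
  apply: contraNneq uP => w0; rewrite (_ : u = 0) ?rpred0 //.
  by apply: val_inj; rewrite -tE w0 rmorph0 mulr0.
have cM (y : 'O K) : y != 0 -> v (i (t * val y)) = v (i t) + v (i (val y)).
  by move=> y0; rewrite rmorphM cvalM ?fmorph_eq0.
have vw : v (i t) + v (i (val w)) = 0 by rewrite -cM // tE cval_unit.
have vw1 : 1 <= v (i (val w)) by rewrite -cval_prime.
have tx0 : toO (tP xP) != 0.
  by rewrite -(inj_eq val_inj) val_toO rmorph0 mulf_neq0.
have := cval_int tx0; rewrite val_toO cM // vx; lia.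
Qed.

(** If N m is integral and k = v(N), then s = t^k N has valuation 0, and s m = t^k (N m) is integral
    because N m is in P^k. *)
Lemma localize m : vge v 0 (i m) -> exists2 s : 'O K, s \notin P & val s * m \in OK.
Proof.
move=> vm; have [N N0 NO] := clear_denominator m.
have t0 := inverse_neq0.
have N0K : N%:R != 0 :> K by rewrite rat_fieldExt_natr_eq0 -lt0n.
have NN0 : (N%:R : 'O K) != 0 by rewrite -(inj_eq val_inj) rmorph_nat rmorph0.
have vN : v (i N%:R) = `|v (i N%:R)|%N.
  have -> : N%:R = val (N%:R : 'O K) by rewrite rmorph_nat.
  by rewrite gez0_abs // cval_int.
set k := `|v (i N%:R)|%N in vN.
have NP : ideal_pow P k N%:R.
  by apply/(@cval_adic _ _ C N%:R k); rewrite rmorph_nat /vge vN lexx orbT.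
have bP : ideal_pow P k (toO NO).
  apply/(@cval_adic _ _ C _ k); rewrite val_toO /vge fmorph_eq0.
  have [// | Nm0 /=] := eqVneq (N%:R * m) 0.
  have m0 : m != 0 by apply: contraNneq Nm0 => ->; rewrite mulr0.
  rewrite rmorphM cvalM ?fmorph_eq0 // vN lerDl.
  by move: vm; rewrite /vge fmorph_eq0 (negPf m0).
have sO := inverse_ideal_pow NP; exists (toO sO); last first.
  by rewrite val_toO rmorph_nat -mulrA -(val_toO NO); apply: inverse_ideal_pow.
have s0 : toO sO != 0.
  by rewrite -(inj_eq val_inj) val_toO rmorph0 rmorph_nat mulf_neq0 // expf_neq0.
rewrite cval_prime // val_toO rmorph_nat rmorphM rmorphXn.
rewrite cvalM ?expf_neq0 ?fmorph_eq0 // cvalX ?fmorph_eq0 // cval_inverse vN.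
by rewrite mulN1r addNr.
Qed.

End Inverse.

Lemma uniformizer_exists : nonzero_ideal P -> exists2 pi : C, pi != 0 & v pi = 1.
Proof.
move=> /prime_invertible[t [tP tv]]; have [x [_ x0 vx]] := prime_not_square tP tv.
by exists (i (val x)) => //; rewrite fmorph_eq0.
Qed.

End Valuation.
(** The exact quotients n j / p and n (p - j) / p add up to n, so their floors lose 0 or 1 in total;
    when 1 is lost, neither quotient is an integer. *)
Lemma divn_dual n p j : (0 < j < p)%N ->
  (n * j %/ p + n * (p - j) %/ p = n)%N \/
  (n * j %/ p + n * (p - j) %/ p = n.-1 /\ 0 < n /\
   n * (p - j) %/ p * p < n * (p - j))%N.
Proof.
move=> /andP[j0 jp]; have p0 := ltn_trans j0 jp.
have E1 := divn_eq (n * j) p; have E2 := divn_eq (n * (p - j)) p.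
have l1 := ltn_pmod (n * j) p0; have l2 := ltn_pmod (n * (p - j)) p0.
have E3 : (n * j + n * (p - j) = n * p)%N by rewrite -mulnDr subnKC // ltnW.
move: E1 E2 l1 l2 E3; move: (n * j)%N (n * (p - j))%N => u w.
move: (u %/ p)%N (u %% p)%N (w %/ p)%N (w %% p)%N => x s y s' -> -> l1 l2.
rewrite addnACA -mulnDl => E4.
have [s0 | s0] := posnP s'.
  left; have xy : (s + s' < p)%N by rewrite s0 addn0.
  have := congr1 (divn^~ p) E4.
  by rewrite divnMDl // (divn_small xy) addn0 mulnK.
right; have le1 : (x + y < n)%N by rewrite -(ltn_pmul2r p0) -E4 -addn1 leq_add2l addn_gt0 s0 orbT.
have le2 : (n < x + y + 2)%N.
  by rewrite -(ltn_pmul2r p0) -E4 [X in (_ < X)%N]mulnDl ltn_add2l mul2n -addnn -addSn leq_add // ltnW.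
by split; [lia | split; [lia | rewrite -addn1 leq_add2l]].
Qed.

(** * Explicit generators of O_{L,P} *)

Section LocallyFree.
Variables (K : fieldExtType rat) (E : splittingFieldType K).
Variables (p : nat) (alpha zeta : E) (a b : 'O K) (sigma tau : gal_of {:E}) (d : nat).
Variable eta : {perm galX tau}.
Hypotheses (p_prime : prime p) (zeta_prim : p.-primitive_root zeta).
Hypothesis p_unr : unramified_in p K.
Hypothesis genE : <<<<1; alpha>>; zeta>>%VS = {:E}%VS.
Hypothesis dimL : \dim <<1; alpha>> = p.
Hypotheses (alphaO : alpha \in algint <<1; alpha>>%AS) (alphaP : alpha ^+ p = (val a)%:A).
Hypothesis aE : a = 1 + p%:R ^+ 2 * b.
Hypothesis d_prim : (p.-1).-primitive_root (d%:R : 'F_p).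
Hypotheses (sigma_alpha : sigma alpha = zeta * alpha) (sigma_zeta : sigma zeta = zeta).
Hypotheses (tau_alpha : tau alpha = alpha) (tau_zeta : tau zeta = zeta ^+ d).
Hypothesis etaE : forall i : nat, eta (mkcoset <[tau]> (sigma ^+ i)%g) =
  mkcoset <[tau]> (sigma ^+ i * sigma^-1)%g.
Variables (P : prime_idealr ('O K)) (C : completion P).

Local Notation L := <<1; alpha>>%AS.
Local Notation OE := (algint {:E}%AS).
Local Notation OK := (algint (aspacef K)).
Local Notation Lc := (Lcomb p alpha).
Local Notation A := (assocO alpha sigma eta).
Local Notation v := (@cval _ _ C).
Local Notation i := (cemb C).
Local Notation f := (cemb_int C).

Let p0 : (0 < p)%N := prime_gt0 p_prime.
Let pK : p%:R != 0 :> K.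
Proof. by rewrite rat_fieldExt_natr_eq0 -lt0n. Qed.
Let aK : val a != 0 := a_neq0 p_prime dimL alphaP.
Let assocE := assoc_eigenvalues p_prime zeta_prim p_unr genE dimL alphaO alphaP
  aE d_prim sigma_alpha sigma_zeta tau_alpha tau_zeta etaE.
Let assocI := assoc_of_eigenvalues p_prime zeta_prim p_unr genE dimL alphaO alphaP
  aE d_prim sigma_alpha sigma_zeta tau_alpha tau_zeta etaE.
Let assoc_inj := assoc_act_inj p_prime zeta_prim genE dimL alphaP
  d_prim sigma_alpha sigma_zeta tau_alpha tau_zeta etaE.
Let Lc_inj := Lcomb_inj p_prime zeta_prim dimL alphaO alphaP sigma_alpha sigma_zeta.

Definition toV (x : C) (xV : x \in @valint K P C) : valring C := Sub x xV.

Lemma val_toV x (xV : x \in @valint K P C) : val (toV xV) = x.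
Proof. exact: SubK. Qed.

Lemma valintE (x : C) : x != 0 -> (x \in @valint K P C) = (0 <= v x).
Proof. by move=> x0; rewrite /valint unfold_in /= /vge (negPf x0). Qed.

Definition toL (x : E) (xL : x \in algint L) : intring L := Sub x xL.

Lemma val_toL x (xL : x \in algint L) : val (toL xL) = x.
Proof. exact: SubK. Qed.

Lemma intringL_coords (y : intring L) : exists m, val y = Lc m.
Proof.
by apply: (LcombP dimL); have := valP y; rewrite algintE => /andP[].
Qed.

Lemma intringL_int (y : intring L) : val y \in OE.
Proof. by have := valP y; rewrite algintE => /andP[]. Qed.

(** * Primes above p *)

Section AtP.
Hypothesis pP : p%:R \in P.

Definition geometric : intring L :=
  toL (geometric_int p_prime zeta_prim dimL alphaO alphaP aE).

Lemma val_geometric : val geometric = Lc (fun=> p%:R^-1).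
Proof.
rewrite val_toL mulr_sumr; apply: eq_bigr => j _.
by rewrite -mulr_algl -in_algE fmorphV rmorph_nat.
Qed.

Lemma geometric_act_inj (h h' : A) :
  assoc_act h geometric = assoc_act h' geometric -> h = h'.
Proof.
move=> /(congr1 val); have [lam [_ lamE]] := assocE h; have [lam' [_ lamE']] := assocE h'.
rewrite ![X in X = _ -> _]SubK [X in _ = X -> _]SubK val_geometric lamE lamE' => /Lc_inj lam_eq; apply: assoc_inj => j jp.
rewrite -[alpha ^+ j]scale1r -(Lcomb_delta _ _ jp) lamE lamE'.
apply: eq_bigr => k _; congr (_ *: _); case: eqP => [-> | _]; last by rewrite !mulr0.
by rewrite (mulIf (invr_neq0 pK) (lam_eq j jp)).
Qed.

(** For y = [Lcomb m] take the eigenvalues lam_j = p a m_j. They are integral by the trace pairing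
    and congruent modulo p by [coef_congr]; the coordinates 1/p of the geometric sum turn them into
    a m_j. *)
Lemma geometric_act_surj (y : intring L) : exists h : A, assoc_act h geometric = a *: y.
Proof.
have [m mE] := intringL_coords y; have yO := intringL_int y.
have mO : Lc m \in OE by rewrite -mE.
have m0O := coef0_int p_prime zeta_prim sigma_alpha sigma_zeta mO.
have lamO j : (j < p)%N -> p%:R * val a * m j \in OK.
  case: j => [_ | j jp].
    by rewrite mulrAC rpredM ?(valP a).
  exact: (coef_dual_int p_prime zeta_prim dimL alphaO alphaP sigma_alpha sigma_zeta).
pose lam j := if insub (p%:R * val a * m j) is Some z then z : 'O K else 0.
have lamE j : (j < p)%N -> val (lam j) = p%:R * val a * m j.
  by move=> jp; rewrite /lam insubT ?lamO // => z; rewrite SubK.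
have lam_congr j : (j < p)%N -> exists w, lam j = lam 0%N + p%:R * w.
  case: j => [_ | j jp]; first by exists 0; rewrite mulr0 addr0.
  have cO := coef_congr p_prime zeta_prim dimL alphaO alphaP sigma_alpha sigma_zeta
    aE p_unr (jp : (0 < j.+1 < p)%N) mO.
  (* lam_j - lam_0 = p ((a m_j - m_0) - (a - 1) m_0), where (a - 1) m_0 = p b (p m_0) is
     integral. *)
  exists (toO cO - p%:R * b * toO m0O); apply: val_inj.
  have aEK : val a = 1 + p%:R ^+ 2 * val b.
    by rewrite aE rmorphD rmorphM rmorphXn rmorph_nat rmorph1.
  rewrite rmorphD rmorphM rmorphB !rmorphM rmorph_nat.
  rewrite [LHS]lamE // [X in _ = X + _]lamE //.
  rewrite [X in _ = _ + _ * (X - _)]val_toO [X in _ = _ + _ * (_ - _ * X)]val_toO.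
  by rewrite aEK -/(val b); ring.
have [h hE] := assocI lam_congr; exists h; apply: val_inj.
rewrite SubK val_geometric hE /= mE /Lcomb scaler_sumr; apply: eq_bigr => j _.
by rewrite scalerA lamE // mulrC mulrA mulKf.
Qed.

(** As a = 1 modulo p, a is a unit at P. Let psi(y) be the operator taking the geometric sum to a y,
    linear in y by uniqueness; the inverse map sends s tensor y to s a^-1 tensor psi(y). *)
Lemma free_at_p : free_generator sigma eta (tens f 1 geometric).
Proof.
have /choice[psi psiE] := geometric_act_surj.
have psiD y z : psi (y + z) = psi y + psi z.
  by apply: geometric_act_inj; rewrite assoc_actDl !psiE scalerDr.
have psiZ r y : psi (r *: y) = r *: psi y.
  by apply: geometric_act_inj; rewrite assoc_actZl !psiE !scalerA mulrC.
have aP : a \notin P.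
  apply/negP => aP; case/negP: (primeN1 P).
  have -> : 1 = a - p%:R * b * p%:R by rewrite aE; ring.
  by rewrite rpredB // primeMl.
have aC : i (val a) != 0 by rewrite fmorph_eq0.
have uV : (i (val a))^-1 \in @valint K P C.
  by rewrite valintE ?invr_eq0 // cvalV // cval_unit.
pose u := toV uV.
have ua : u * f a = 1 by apply: val_inj; rewrite rmorphM /= mulVf.
pose phi (s : valring C) (y : intring L) := tens f (s * u) (psi y).
have phiDl s s' y : phi (s + s') y = phi s y + phi s' y by rewrite /phi mulrDl tensDl.
have phiDr s y z : phi s (y + z) = phi s y + phi s z by rewrite /phi psiD tensDr.
have phiB s r y : phi (s * f r) y = phi s (r *: y).
  by rewrite /phi psiZ -tens_balanced mulrAC.
have lactE s h y : local_act (tens f s (h : A)) (tens f 1 y) = tens f s (assoc_act h y).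
  by rewrite local_actE mulr1.
apply: (free_generatorI (g := tensor_lift phi)).
- exact: tensor_liftD.
- move=> s h; rewrite lactE tensor_liftE // /phi.
  have -> : psi (assoc_act h geometric) = a *: h.
    by apply: geometric_act_inj; rewrite psiE assoc_actZl.
  by rewrite -tens_balanced -mulrA ua mulr1.
- move=> s y; rewrite tensor_liftE // /phi lactE psiE -tens_balanced.
  by rewrite -mulrA ua mulr1.
Qed.

End AtP.

(** * Primes not above p *)

Section AwayFromP.
Hypothesis pP : p%:R \notin P.
Variable t : K.
Hypothesis tP : forall x : 'O K, x \in P -> t * val x \in OK.
Hypothesis tv : exists w u : 'O K, [/\ w \in P, u \notin P & t * val w = val u].
Variable pi : C.
Hypotheses (pi0 : pi != 0) (vpi : v pi = 1).

Let t0 : t != 0 := inverse_neq0 tv.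
Let vt : v (i t) = -1 := cval_inverse C tP tv.
Let aC : i (val a) != 0.
Proof. by rewrite fmorph_eq0. Qed.
Let tC : i t != 0.
Proof. by rewrite fmorph_eq0. Qed.
Let pC : i p%:R != 0.
Proof. by rewrite fmorph_eq0. Qed.
Let vp : v (i p%:R) = 0.
Proof.
have -> : p%:R = val (p%:R : 'O K) by rewrite rmorph_nat.
exact: cval_unit.
Qed.

Let n := `|v (i (val a))|%N.
Let va : v (i (val a)) = n.
Proof. by rewrite /n gez0_abs // cval_int. Qed.

(** This is r_P(a^j), see [rfloorE]. *)
Definition rexp j := (n * j %/ p)%N.

Lemma rfloorE j : rfloor p C (val a ^+ j) = rexp j.
Proof. by rewrite /rfloor rmorphXn cvalX // va -PoszM divz_nat. Qed.

Lemma rpow_int j : t ^+ (rexp j * p) * val a ^+ j \in OK.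
Proof.
rewrite -rmorphXn; apply: (inverse_ideal_pow tP).
apply/(@cval_adic _ _ C (a ^+ j)); rewrite /vge !rmorphXn cvalX // va -PoszM lez_nat.
by rewrite leq_divM orbT.
Qed.

Lemma rbasis_pow j : (t ^+ rexp j *: alpha ^+ j) ^+ p = (t ^+ (rexp j * p) * val a ^+ j)%:A.
Proof.
rewrite exprZn -!exprM [(j * p)%N]mulnC [alpha ^+ _]exprM alphaP.
by rewrite -scalerA; congr (_ *: _); rewrite -[RHS]in_algE rmorphXn.
Qed.

(** The p-th power is in O_K, because a^j lies in P^(p r_j). Using t in place of 1/pi keeps these
    basis elements inside L. *)
Lemma rbasis_int j : t ^+ rexp j *: alpha ^+ j \in algint L.
Proof.
rewrite algintE; apply/andP; split; first by rewrite rpredZ ?rpredX ?memv_adjoin.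
apply: (@monic_root_algint _ _ ('X ^+ p - (t ^+ (rexp j * p) * val a ^+ j)%:A%:P)).
- by rewrite monicXnsubC.
- by rewrite /root !hornerE rbasis_pow subrr.
- move=> k; rewrite coefB coefXn coefC; apply: rpredB; first exact: rpred_nat.
  by case: ifP => _; rewrite ?rpred0 // algint_alg rpow_int.
Qed.

Definition rbasis j := toL (rbasis_int j).

Lemma val_rbasis j : val (rbasis j) = t ^+ rexp j *: alpha ^+ j.
Proof. exact: SubK. Qed.

Lemma rexp_dual j : (0 < j < p)%N ->
  (rexp j + rexp (p - j) = n)%N \/
  (rexp j + rexp (p - j) = n.-1 /\ 0 < n /\ rexp (p - j) * p < n * (p - j))%N.
Proof. exact: divn_dual. Qed.

(* O_{L,P} is spanned by the t^(r_j) alpha^j: pair y with the dual power of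
   alpha; when p does not divide v(a), this power is nilpotent modulo P, and
   so the trace gains a factor in P. *)
Lemma rcoord_int (y : intring L) m j : val y = Lc m -> (j < p)%N ->
  vge v 0 (i (m j / t ^+ rexp j)).
Proof.
move=> yE jp; have yO := intringL_int y; rewrite /vge fmorph_eq0.
have [// | mj0 /=] := eqVneq (m j / t ^+ rexp j) 0.
have mj : m j != 0 by apply: contraNneq mj0 => ->; rewrite mul0r.
have vm : v (i (m j / t ^+ rexp j)) = v (i (m j)) + (rexp j)%:Z.
  rewrite rmorphM fmorphV rmorphXn cvalM ?fmorph_eq0 ?invr_eq0 ?expf_neq0 //.
  by rewrite cvalV ?expf_neq0 // cvalX // vt mulN1r opprK.
have [j0 | j0] := posnP j.
  (* For j = 0 the trace of y is p m_0, and p is a unit at P. *)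
  have mO : Lc m \in OE by rewrite -yE.
  have m0O := coef0_int p_prime zeta_prim sigma_alpha sigma_zeta mO.
  have z0 : toO m0O != 0.
    by rewrite -(inj_eq val_inj) val_toO rmorph0 mulf_neq0 // -j0.
  have := cval_int C z0; rewrite val_toO rmorphM cvalM ?fmorph_eq0 -?j0 // vp add0r vm => H.
  by rewrite addr_ge0.
have jlt : (0 < j < p)%N by rewrite j0.
pose r' := rexp (p - j); pose x := val y * (t ^+ r' *: alpha ^+ (p - j)).
have xO : x \in OE.
  rewrite rpredM //; have := rbasis_int (p - j); rewrite algintE => /andP[] //.
have trE : Ltrace p sigma x = (p%:R * val a * (t ^+ r' * m j))%:A.
  have -> : x = Lc (fun k => t ^+ r' * m k) * alpha ^+ (p - j).
    rewrite /x yE -scalerAr scalerAl /Lcomb scaler_sumr; congr (_ * _).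
    by apply: eq_bigr => k _; rewrite scalerA.
  exact: (Ltrace_dual p_prime zeta_prim dimL alphaO alphaP sigma_alpha sigma_zeta).
have TO : p%:R * val a * (t ^+ r' * m j) \in OK.
  by rewrite -(@algint_alg _ E) -trE; apply: Ltrace_int.
have T0 : toO TO != 0.
  by rewrite -(inj_eq val_inj) val_toO rmorph0 !mulf_neq0 ?expf_neq0.
have vT : v (i (val (toO TO))) = n%:Z - r'%:Z + v (i (m j)).
  rewrite val_toO !rmorphM rmorphXn !cvalM ?mulf_neq0 ?expf_neq0 ?fmorph_eq0 //.
  by rewrite vp add0r va cvalX // vt mulN1r addrA.
(* The trace T has valuation n - r' + v(m_j). Integrality of T is enough when r_j + r' = n; when r_j
   + r' = n - 1, T must be shown to lie in P. *)
have [rr | [rr [n0 rlt]]] := rexp_dual jlt.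
  have := cval_int C T0; rewrite vT vm -rr -/r'; clear; lia.
suff : toO TO \in P by rewrite (cval_prime C) // vT vm -/r'; clear -rr n0; rewrite -/r' in rr; lia.
have qO := rpow_int (p - j).
have q0 : toO qO != 0.
  by rewrite -(inj_eq val_inj) val_toO rmorph0 mulf_neq0 ?expf_neq0.
(* q = t^(p r') a^(p-j) is the p-th power of the dual basis element; its valuation n (p - j) - p r'
   is positive. By [Ltrace_nil] a power of T is divisible by q. *)
have qP : toO qO \in P.
  rewrite (cval_prime C) // val_toO rmorphM !rmorphXn cvalM ?expf_neq0 //.
  rewrite !cvalX // vt va mulN1r -PoszM; clear -rlt; lia.
have [|||l [w E1]] := @Ltrace_nil _ E p sigma (toO qO) x p (val y ^+ p) q0 xO _ _ (toO TO).
- by rewrite rpredX.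
- by rewrite /x exprMn rbasis_pow mulrC val_toO.
- by rewrite trE val_toO.
by apply: (primeX (n := l)); rewrite E1 mulrC primeMl.
Qed.

(** Coordinates on the t^(r_j) alpha^j; they lie in K and are integral at P, not necessarily at
    other primes. *)
Definition rcoord (y : intring L) j : K :=
  sval (cid (intringL_coords y)) j / t ^+ rexp j.

Let tX j : t ^+ rexp j != 0.
Proof. exact: expf_neq0. Qed.

Lemma rcoordE (y : intring L) : val y = Lc (fun j => rcoord y j * t ^+ rexp j).
Proof.
rewrite {1}(svalP (cid (intringL_coords y))).
by apply: eq_bigr => j _; rewrite divfK.
Qed.

Lemma rcoord_uniq (y : intring L) m : val y = Lc (fun j => m j * t ^+ rexp j) ->
  forall j, (j < p)%N -> rcoord y j = m j.
Proof. by rewrite rcoordE => /Lc_inj eqm j jp; apply: (mulIf (tX j)); apply: eqm. Qed.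

Lemma rcoord_valint (y : intring L) (j : 'I_p) : i (rcoord y j) \in @valint K P C.
Proof. exact: (rcoord_int (svalP (cid (intringL_coords y))) (ltn_ord j)). Qed.

Definition rcoordV (y : intring L) (j : 'I_p) : valring C := toV (rcoord_valint y j).

Lemma rcoordVD y z j : rcoordV (y + z) j = rcoordV y j + rcoordV z j.
Proof.
suff rD : rcoord (y + z) j = rcoord y j + rcoord z j.
  by apply: val_inj; exact: (etrans (congr1 i rD) (rmorphD i _ _)).
apply: (@rcoord_uniq _ (fun j => rcoord y j + rcoord z j)) => //.
transitivity (val y + val z); first by [].
rewrite (rcoordE y) (rcoordE z) -big_split.
by apply: eq_bigr => k _; rewrite /= mulrDl scalerDl.
Qed.

Lemma rcoordVZ (r : 'O K) y j : rcoordV (r *: y) j = f r * rcoordV y j.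
Proof.
suff rZ : rcoord (r *: y) j = val r * rcoord y j.
  by apply: val_inj; exact: (etrans (congr1 i rZ) (rmorphM i _ _)).
apply: (@rcoord_uniq _ (fun j => val r * rcoord y j)) => //.
transitivity (val r *: val y); first by [].
rewrite (rcoordE y) scaler_sumr.
by apply: eq_bigr => k _; rewrite scalerA mulrA.
Qed.

Lemma rcoordV_basis (j k : 'I_p) : rcoordV (rbasis k) j = (j == k)%:R.
Proof.
suff r1 : rcoord (rbasis k) j = (j == k)%:R.
  by apply: val_inj; rewrite [RHS]rmorph_nat; exact: (etrans (congr1 i r1) (rmorph_nat i _)).
apply: (@rcoord_uniq _ (fun j => ((j == k :> nat)%:R : K))) => //.
rewrite val_rbasis -(@Lcomb_delta _ _ p) //; apply: eq_bigr => l _; congr (_ *: _).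
by case: eqP => [-> | _]; rewrite ?mul1r ?mul0r.
Qed.

(** The coordinates of y need not be in O_K, so they cannot cross the tensor sign directly. A common
    denominator S outside P is a unit of O_{K,P}: write s tensor y as s S^-1 tensor S y, expand S y
    over O_K, and move the coefficients back. *)
Lemma tens_rbasis (s : valring C) y :
  tens f s y = \sum_(j < p) tens f (s * rcoordV y j) (rbasis j).
Proof.
have /choice[q Hq] : forall j : 'I_p, exists x : 'O K,
    x \notin P /\ val x * rcoord y j \in OK.
  move=> j; have [x xP xO] := localize tP tv (rcoord_valint y j).
  by exists x.
pose S := \prod_j q j.
have SP : S \notin P.
  apply: (big_ind (fun x => x \notin P)) => [|x z xP zP|j _]; first exact: primeN1.
    by rewrite prime_idealrM negb_or xP.
  by have [] := Hq j.
have SO (j : 'I_p) : val S * rcoord y j \in OK.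
  have -> : S = (\prod_(k | k != j) q k) * q j by rewrite /S (bigD1 j) // mulrC.
  by rewrite rmorphM -mulrA; apply: rpredM; [exact: valP | have [] := Hq j].
have S0 : i (val S) != 0.
  by rewrite fmorph_eq0; apply: contraNneq SP => S0; rewrite (_ : S = 0) ?rpred0 //; apply: val_inj.
have sV : (i (val S))^-1 \in @valint K P C.
  by rewrite valintE ?invr_eq0 // cvalV // cval_unit.
have sS : toV sV * f S = 1 by apply: val_inj; rewrite rmorphM /= mulVf.
have yE : S *: y = \sum_(j < p) toO (SO j) *: rbasis j.
  apply: val_inj; transitivity (val S *: val y); first by [].
  rewrite (rcoordE y) scaler_sumr rmorph_sum; apply: eq_bigr => j _.
  transitivity (val (toO (SO j)) *: val (rbasis j)); last by [].
  by rewrite val_rbasis val_toO !scalerA mulrA.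
rewrite -[s in LHS]mulr1 -sS mulrA tens_balanced yE tens_sumr; apply: eq_bigr => j _.
rewrite -tens_balanced -mulrA; congr (tens f (s * _) _).
apply: val_inj; transitivity ((i (val S))^-1 * i (val (toO (SO j)))); first by [].
by rewrite val_toO rmorphM mulKf.
Qed.

(** e is p times the projection onto alpha^j: the factor p makes its eigenvalues congruent modulo p,
    and it becomes invertible at P. *)
Lemma eigen_idempotent (j : 'I_p) : exists e : A,
  forall k : 'I_p, assoc_act e (rbasis k) = ((k == j)%:R * p%:R) *: rbasis k.
Proof.
have [|e eE] := assocI (lam := fun k => (k == j :> nat)%:R * p%:R).
  move=> k kp; exists ((k == j :> nat)%:R - (0%N == j :> nat)%:R).
  by rewrite mulrBr ![p%:R * _]mulrC addrC subrK.
exists e => k; apply: val_inj; rewrite [LHS]SubK val_rbasis -(@Lcomb_delta _ _ p) // eE.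
transitivity (((k == j)%:R * p%:R) *: (t ^+ rexp k *: alpha ^+ k)); last first.
  have cE : val ((k == j)%:R * p%:R : 'O K) = (k == j)%:R * p%:R by rewrite rmorphM !rmorph_nat.
  by rewrite -cE -val_rbasis.
rewrite scalerA -[RHS](@Lcomb_delta _ _ p) //; apply: eq_bigr => l _; congr (_ *: _).
have [-> | _] := eqVneq (l : nat) k; last by rewrite mulr0.
by rewrite rmorphM !rmorph_nat.
Qed.

(** A unit of O_{K,P}, which exchanges t and 1/pi: w^-r t^r = pi^-r. *)
Let w := pi * i t.
Let w0 : w != 0.
Proof. by rewrite mulf_neq0. Qed.
Let vw : v w = 0.
Proof. by rewrite cvalM // vpi vt. Qed.

Fact unitV_subproof k : w ^+ k \in @valint K P C.
Proof. by rewrite valintE ?expf_neq0 // cvalX // vw mul0r. Qed.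
Fact unitVV_subproof k : w ^- k \in @valint K P C.
Proof. by rewrite valintE ?invr_eq0 ?expf_neq0 // cvalV ?expf_neq0 // cvalX // vw mul0r. Qed.
Fact pinv_subproof : (i p%:R)^-1 \in @valint K P C.
Proof. by rewrite valintE ?invr_eq0 // cvalV // vp. Qed.

Let eps k := toV (unitVV_subproof k).
Let epsV k := toV (unitV_subproof k).
Let pinv := toV pinv_subproof.
Let epsK k : eps k * epsV k = 1.
Proof. by apply: val_inj; rewrite rmorphM /= mulVf ?expf_neq0. Qed.
Let pinvK : pinv * f p%:R = 1.
Proof.
apply: val_inj; transitivity ((i p%:R)^-1 * i (val (p%:R : 'O K))); first by [].
have -> : val (p%:R : 'O K) = p%:R by rewrite rmorph_nat.
by rewrite mulVf.
Qed.

Definition local_generator : at_prime C (intring L) :=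
  \sum_(j < p) tens f (pinv * eps (rexp j)) (rbasis j).

Lemma to_local_generator : to_local_field local_generator = xgen alpha p (val a) pi.
Proof.
rewrite /xgen (negPf pP) scaler_sumr; apply: etrans (to_local_field_sum _ _ _) _.
apply: eq_bigr => j _; rewrite to_local_fieldE val_rbasis linearZ /= -tens_balanced tensZ.
congr (tens _ _ _); rewrite rfloorE /= -exprnP.
rewrite -[X in X / _ * _ = _]/((i p%:R)^-1) rmorph_nat rmorphXn /w exprMn invfM -!mulrA.
by rewrite mulVf ?mulr1 ?expf_neq0.
Qed.

(** e_j extracts from the generator w^(-r_j) times the j-th basis element. So the inverse map sends
    s tensor y to the sum of the s y_j w^(r_j) tensor e_j, where y_j are the coordinates of y. *)
Lemma free_away_from_p : free_generator sigma eta local_generator.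
Proof.
have /choice[e eE] := eigen_idempotent.
pose phi (s : valring C) (y : intring L) :=
  \sum_(j < p) tens f (s * rcoordV y j * epsV (rexp j)) (e j).
have phiDl s s' y : phi (s + s') y = phi s y + phi s' y.
  by rewrite -big_split; apply: eq_bigr => j _; rewrite !mulrDl tensDl.
have phiDr s y z : phi s (y + z) = phi s y + phi s z.
  by rewrite -big_split; apply: eq_bigr => j _; rewrite rcoordVD mulrDr mulrDl tensDl.
have phiB s r y : phi (s * f r) y = phi s (r *: y).
  by apply: eq_bigr => j _; rewrite rcoordVZ mulrA.
have phiD := tensor_liftD phiDl phiDr phiB.
have phiE := tensor_liftE phiDl phiDr phiB.
have lactE s (h : A) : local_act (tens f s h) local_generator =
    \sum_(k < p) tens f (s * (pinv * eps (rexp k))) (assoc_act h (rbasis k)).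
  apply: etrans (local_act_sumr _ _ _ _) _.
  by apply: eq_bigr => k _; apply: local_actE.
apply: (free_generatorI (g := tensor_lift phi)); first exact: phiD.
- move=> s h; rewrite lactE (additive_sum phiD).
  have [lam [_ lamE]] := assocE h.
  have hE (k : 'I_p) : assoc_act h (rbasis k) = lam k *: rbasis k.
    apply: val_inj; rewrite [LHS]SubK val_rbasis -(@Lcomb_delta _ _ p) // lamE.
    transitivity (val (lam k) *: val (rbasis k)); last by [].
    rewrite val_rbasis scalerA -[X in _ = X](@Lcomb_delta _ _ p) //; apply: eq_bigr => l _; congr (_ *: _).
    by case: eqP => [-> | _]; rewrite ?mulr0.
  (* p h and sum_k lam_k e_k have the same eigenvalues, and p is invertible in O_{K,P}. *)
  have -> : tens f s h = \sum_(k < p) tens f (s * pinv) (lam k *: e k).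
    rewrite -tens_sumr.
    have -> : \sum_(k < p) lam k *: e k = p%:R *: h.
      apply: assoc_inj => j jp.
      have key (g g' : A) : assoc_act g (rbasis j) = assoc_act g' (rbasis j) ->
          hopf_act sigma eta (val g) (alpha ^+ j) = hopf_act sigma eta (val g') (alpha ^+ j).
        move=> /(congr1 val); rewrite ![val (assoc_act _ _)]SubK val_rbasis.
        by rewrite !hopf_act_scale => /(scalerI (tX j)).
      have hEj : assoc_act h (rbasis j) = lam j *: rbasis j := hE (Ordinal jp).
      have eEj k : assoc_act (e k) (rbasis j) = ((Ordinal jp == k)%:R * p%:R) *: rbasis j :=
        eE k (Ordinal jp).
      apply: key; rewrite assoc_actZl hEj.
      rewrite (additive_sum (F := fun g => assoc_act g _)); last by move=> g g'; apply: assoc_actDl.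
      rewrite (bigD1 (Ordinal jp)) //= big1 ?addr0 => [|k kj].
        by rewrite assoc_actZl eEj eqxx mul1r !scalerA mulrC.
      by rewrite assoc_actZl eEj eq_sym (negPf kj) mul0r scale0r scaler0.
    by rewrite -tens_balanced -mulrA pinvK mulr1.
  apply: eq_bigr => k _; rewrite phiE hE /phi (bigD1 k) //= big1 ?addr0 => [|j jk].
    rewrite rcoordVZ rcoordV_basis eqxx mulr1 -tens_balanced; congr (tens _ _ _).
    by rewrite -[RHS]mulr1 -(epsK (rexp k)); ring.
  rewrite rcoordVZ rcoordV_basis (negPf jk) !mulr0 mul0r.
  exact: tens0l.
- move=> s y; rewrite phiE /phi tens_rbasis; apply: etrans (local_act_suml _ _ _ _) _.
  apply: eq_bigr => j _; apply: etrans (lactE _ _) _.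
  rewrite (bigD1 j) //= big1 ?addr0 => [|k kj].
    rewrite eE eqxx mul1r -tens_balanced; congr (tens _ _ _).
    rewrite -[RHS]mulr1 -[X in _ = _ * X]mulr1 -{1}(epsK (rexp j)) -pinvK; ring.
  by rewrite eE (negPf kj) mul0r scale0r tens0r.
Qed.

End AwayFromP.
End LocallyFree.
Theorem theorem5p1 (K : fieldExtType rat) (E : splittingFieldType K)
    (p : nat) (alpha zeta : E) (a : 'O K)
    (sigma tau : gal_of {:E}) (d : nat) (eta : {perm galX tau}) :
  prime p ->
  p.-primitive_root zeta ->
  zeta \notin 1%VS ->
  unramified_in p K ->
  <<<<1; alpha>>; zeta>>%VS = {:E}%VS ->
  \dim <<1; alpha>> = p ->
  alpha \in algint <<1; alpha>>%AS ->
  alpha ^+ p = (val a)%:A ->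
  (exists b : 'O K, a = 1 + p%:R ^+ 2 * b) ->
  at_most_tame <<1; alpha>>%AS ->
  (p.-1).-primitive_root (d%:R : 'F_p) ->
  sigma alpha = zeta * alpha -> sigma zeta = zeta ->
  tau alpha = alpha -> tau zeta = zeta ^+ d ->
  (forall i : nat, eta (mkcoset <[tau]> (sigma ^+ i)%g) =
                   mkcoset <[tau]> (sigma ^+ i * sigma^-1)%g) ->
  [/\ assoc_order alpha sigma eta =i int_hopf_order eta,
      locally_free_rank1 alpha sigma eta
    & forall (P : prime_idealr ('O K)) (C : completion P) (pi : C),
        nonzero_ideal P -> pi != 0 -> cval pi = 1 ->
        exists x : at_prime C (intring <<1; alpha>>%AS),
          to_local_field x = xgen alpha p (val a) pi /\
          free_generator sigma eta x].
Proof.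
move=> p_prime zeta_prim _ p_unr genE dimL alphaO alphaP [b aE] _ d_prim.
move=> sigma_alpha sigma_zeta tau_alpha tau_zeta etaE.
have local (P : prime_idealr ('O K)) (C : completion P) (pi : C) :
    nonzero_ideal P -> pi != 0 -> cval pi = 1 ->
    exists x : at_prime C (intring <<1; alpha>>%AS),
      to_local_field x = xgen alpha p (val a) pi /\ free_generator sigma eta x.
  move=> P0 pi0 vpi; case: (boolP (p%:R \in P)) => pP.
    exists (tens (cemb_int C) 1 (geometric p_prime zeta_prim dimL alphaO alphaP aE)).
    split; first by rewrite to_local_fieldE /xgen pP.
    exact: (free_at_p p_prime zeta_prim p_unr genE dimL alphaO alphaP aE d_prim).
  have [t [tP tv]] := prime_invertible P0.
  eexists; split.
    exact: (to_local_generator p_prime dimL alphaP pP tP tv pi0 vpi).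
  exact: (free_away_from_p p_prime zeta_prim p_unr genE dimL alphaO alphaP aE d_prim).
split=> [|P C P0|//].
  exact: (assoc_order_eq p_prime zeta_prim p_unr genE dimL alphaO alphaP aE d_prim).
have [pi pi0 vpi] := uniformizer_exists C P0.
by have [x [_ xfree]] := local P C pi P0 pi0 vpi; exists x.
Qed.
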